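(* For every $\epsilon>0$ there exists $m_0$ such that for all integers $n$ and $m$ with $m\geq m_0$ and $m>n\geq 2$, we have $R(K_{1,m}, W_{2n})\leq (2+\epsilon)m+n$.
   Context: For $k\ge 3$, the wheel $W_k$ is the graph on $k+1$ vertices obtained by joining one vertex to every vertex of a cycle of length $k$; also $W_4$ etc. follow this definition, and $W_2=K_3$. $K_{1,m}$ is the star with $m$ leaves. For graphs $H_1,H_2$, the Ramsey number $R(H_1,H_2)$ is the smallest integer $N$ such that in every coloring of the edges of $K_N$ with colors 1 and 2 there is a copy of $H_1$ in color 1 or a copy of $H_2$ in color 2. *)

(* Defs.v *)
From HB Require Import structures.
From mathcomp Require Import all_boot all_order all_algebra.
From mathcomp Require Import reals.

Set Implicit Arguments.
Unset Strict Implicit.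
Unset Printing Implicit Defensive.

Record sgraph := SGraph {
  vertex :> finType;
  adj : rel vertex;
  adj_sym : symmetric adj;
  adj_irr : irreflexive adj }.

(* [contains G H]: G has a (not necessarily induced) subgraph isomorphic
   to H. *)
Definition contains (G H : sgraph) : bool :=
  [exists f : {ffun H -> G},
     injectiveb f && [forall x, forall y, adj x y ==> adj (f x) (f y)]].

Section Constructions.

Variable G : sgraph.

(* The join of a new vertex [None] with G. *)
Definition cone_rel : rel (option G) := fun x y =>
  match x, y with
  | None, None => false
  | Some u, Some v => adj u v
  | _, _ => true
  end.

Lemma cone_sym : symmetric cone_rel.
Proof. by move=> [u|] [v|] //=; rewrite adj_sym. Qed.

Lemma cone_irr : irreflexive cone_rel.
Proof. by move=> [u|] //=; rewrite adj_irr. Qed.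

Definition cone := SGraph cone_sym cone_irr.

End Constructions.

Section Families.

Variable k : nat.

Definition empty_rel : rel 'I_k := fun _ _ => false.

Lemma empty_sym : symmetric empty_rel. Proof. by []. Qed.
Lemma empty_irr : irreflexive empty_rel. Proof. by []. Qed.

Definition edgeless := SGraph empty_sym empty_irr.

Definition cycle_rel : rel 'I_k := fun i j =>
  (i != j) && ((j == i.+1 %% k :> nat) || (i == j.+1 %% k :> nat)).

Lemma cycle_sym : symmetric cycle_rel.
Proof. by move=> i j; rewrite /cycle_rel eq_sym orbC. Qed.

Lemma cycle_irr : irreflexive cycle_rel.
Proof. by move=> i; rewrite /cycle_rel eqxx. Qed.

(* The cycle of length k when k >= 3; for k = 2 it is a single edge, so that
   [wheel 2] is K_3. *)
Definition cycle_graph := SGraph cycle_sym cycle_irr.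

End Families.

Definition star (m : nat) : sgraph := cone (edgeless m).
Definition wheel (k : nat) : sgraph := cone (cycle_graph k).

(* A 2-colouring of the edges of K_N is a function on the subsets of 'I_N, of
   which only the values at the 2-element sets {x, y} are ever used. Colour 1
   is [true] and colour 2 is [false]. *)
Definition coloring (N : nat) := {ffun {set 'I_N} -> bool}.

Section ColorGraph.

Variables (N : nat) (c : coloring N) (a : bool).

Definition color_rel : rel 'I_N := fun x y =>
  (x != y) && (c [set x; y] == a).

Lemma color_sym : symmetric color_rel.
Proof. by move=> x y; rewrite /color_rel eq_sym setUC. Qed.

Lemma color_irr : irreflexive color_rel.
Proof. by move=> x; rewrite /color_rel eqxx. Qed.

Definition color_graph := SGraph color_sym color_irr.

End ColorGraph.

Definition arrows (H1 H2 : sgraph) (N : nat) : bool :=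
  [forall c : coloring N,
     contains (color_graph c true) H1 || contains (color_graph c false) H2].

Lemma ramsey_clique (s t : nat) : exists N, forall (T : finType) (e : rel T)
    (A : {set T}), symmetric e -> N <= #|A| ->
  (exists B : {set T}, #|B| = s /\ {in B &, forall x y, x != y -> e x y}) \/
  (exists B : {set T}, #|B| = t /\ {in B &, forall x y, x != y -> ~~ e x y}).
Proof.
suff [N HN] : exists N, forall (T : finType) (e : rel T)
    (A : {set T}), symmetric e -> N <= #|A| ->
  (exists B : {set T},
     [/\ B \subset A, #|B| = s & {in B &, forall x y, x != y -> e x y}]) \/
  (exists B : {set T},
     [/\ B \subset A, #|B| = t & {in B &, forall x y, x != y -> ~~ e x y}]).
  exists N => T e A es leA.
  by have [[B [_ ? ?]]|[B [_ ? ?]]] := HN T e A es leA; [left | right]; exists B.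
elim: s t => [|s IHs] t.
  exists 0 => T e A _ _; left; exists set0.
  by split; rewrite ?sub0set ?cards0 // => x y; rewrite inE.
elim: t => [|t [N2 IH2]].
  exists 0 => T e A _ _; right; exists set0.
  by split; rewrite ?sub0set ?cards0 // => x y; rewrite inE.
have [N1 IH1] := IHs t.+1.
exists (N1 + N2).+1 => T e A es leA.
have /card_gt0P [v vA] : 0 < #|A| by apply: leq_trans leA.
have := leA; rewrite (cardsD1 v A) vA add1n ltnS => {}leA.
pose P := [set x | e v x].
have subA (C : {set T}) : C \subset A :\ v -> v |: C \subset A /\ #|v |: C| = #|C|.+1.
  move=> sC; split.
    by rewrite subUset sub1set vA (subset_trans sC) ?subsetDl.
  rewrite cardsU1; case: (boolP (v \in C)) => // /(subsetP sC).
  by rewrite !inE eqxx.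
have ext (p : rel T) (C : {set T}) : symmetric p -> {in C, forall x, p v x} ->
    {in C &, forall x y, x != y -> p x y} ->
    {in v |: C &, forall x y, x != y -> p x y}.
  move=> ps pv pC x y; rewrite !inE => /predU1P[->|xC] /predU1P[->|yC].
  - by rewrite eqxx.
  - by move=> _; apply: pv.
  - by move=> _; rewrite ps; apply: pv.
  - exact: pC.
case: (leqP N1 #|(A :\ v) :&: P|) => [le1|lt1].
  have [[B [sB cB eB]]|[B [sB cB eB]]] := IH1 T e _ es le1.
    have [sI sP] : B \subset A :\ v /\ B \subset P.
      by move: sB; rewrite subsetI => /andP[].
    have [s1 c1] := subA _ sI.
    left; exists (v |: B); split; rewrite ?c1 ?cB //.
    by apply: ext => // x /(subsetP sP); rewrite inE.
  right; exists B; split=> //.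
  by rewrite (subset_trans sB) // (subset_trans (subsetIl _ _)) // subsetDl.
have le2 : N2 <= #|(A :\ v) :\: P|.
  rewrite -(cardsID P (A :\ v)) in leA.
  rewrite -(leq_add2l N1); apply: leq_trans leA _.
  by rewrite leq_add2r ltnW.
have [[B [sB cB eB]]|[B [sB cB eB]]] := IH2 T e _ es le2.
  left; exists B; split=> //.
  by rewrite (subset_trans sB) // (subset_trans (subsetDl _ _)) // subsetDl.
have [s1 c1] := subA _ (subset_trans sB (subsetDl _ _)).
right; exists (v |: B); split; rewrite ?c1 ?cB //.
apply: (ext (fun x y => ~~ e x y)) => // [x y|x /(subsetP sB)].
  by rewrite es.
by rewrite !inE => /andP[].
Qed.

Lemma contains_clique (G H : sgraph) (B : {set G}) :
  #|B| = #|H| -> {in B &, forall x y, x != y -> adj x y} -> contains G H.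
Proof.
move=> cB eB; apply/existsP.
pose f (x : H) : G := enum_val (cast_ord (esym cB) (enum_rank x)).
have f_inj : injective f.
  by move=> x y /enum_val_inj /cast_ord_inj /enum_rank_inj.
exists (finfun f); apply/andP; split.
  by apply/injectiveP => x y; rewrite !ffunE => /f_inj.
apply/forallP => x; apply/forallP => y; apply/implyP => xy.
rewrite !ffunE; apply: eB; rewrite ?enum_valP //.
by apply: contraTneq xy => /f_inj ->; rewrite adj_irr.
Qed.

Lemma ramsey_exists (H1 H2 : sgraph) : exists N, arrows H1 H2 N.
Proof.
have [N HN] := ramsey_clique #|H1| #|H2|.
exists N; apply/forallP => c.
have leN : N <= #|[set: 'I_N]| by rewrite cardsT card_ord.
have [[B [cB eB]]|[B [cB eB]]] :=
  HN _ (color_rel c true) _ (@color_sym N c true) leN; apply/orP.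
  by left; apply: (@contains_clique (color_graph c true) _ B).
right; apply: (@contains_clique (color_graph c false) _ B) => // x y xB yB xy.
move: (eB x y xB yB xy); rewrite /= /color_rel xy /=.
by case: (c _).
Qed.

Definition ramsey (H1 H2 : sgraph) : nat := ex_minn (ramsey_exists H1 H2).

(* Main.v *)
(* In colour 2 every vertex misses at most m vertices, itself included, and
   N = 2m + n + (linear slack); a cycle of length 2n inside some neighbourhood is
   wanted.  Let s be a small multiple of m.

   Robust components.  In a dense graph call two vertices linked when they have
   linearly many common neighbours.  Independent sets of the link graph have
   bounded size, so a bounded set of vertices ("skeleton") suffices to join any
   two vertices of the same link component.  Few vertices have many neighbours in
   two link components; after deleting at most s vertices, each remaining vertex
   loses at most s neighbours and the graph splits into parts made of one or two
   link components, all edges of a part going from one of them to the other.  A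
   part with at least 2n + s vertices and minimum degree at least n + s contains
   a cycle of length 2n: a longest-path argument gives two disjoint paths covering
   nearly 2n of its vertices, with even lengths and ends in one link component;
   they are closed up through skeletons, a clique of linked vertices that adjusts
   the length exactly, and a small reservoir that meets every large common
   neighbourhood.

   A large part exists.  Suppose all parts of all neighbourhoods have fewer than
   2n + s vertices.  Each neighbourhood then has several parts, and a vertex of one
   misses nearly all of the other, so parts have at most m + s vertices.  If u, v, x
   form a generic triangle, x lies in the part of v inside N(u), and codeg(v, x) is
   at most m + 2s.  That part contains nearly all of N(u) & (N(v) | N(x)), which has
   at least 3(N - m) - codeg(v, x) - N > 2n + s vertices, a contradiction. *)
Require Import Defs.
From mathcomp Require Import all_boot all_order all_algebra.
From mathcomp Require Import reals zify.

Set Implicit Arguments.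
Unset Strict Implicit.
Unset Printing Implicit Defensive.

(** * Two long disjoint paths *)

Section TwoPaths.

Variables (T : finType) (e : rel T).
Hypotheses (e_sym : symmetric e) (e_irr : irreflexive e).

Lemma greedy_path (D : {set T}) (d : nat) (w : T) : w \in D ->
    {in D, forall x, d <= #|[set y in D | e x y]|} ->
  exists p, [/\ path e w p, uniq (w :: p), {subset w :: p <= D} & size p = d].
Proof.
move=> wD degD.
suff H k : k <= d -> exists p,
    [/\ path e w p, uniq (w :: p), {subset w :: p <= D} & size p = k] by exact: H.
elim: k => [_|k IHk lt_kd].
  by exists [::]; split=> // x; rewrite inE => /eqP->.
have [p [ep up pD sp]] := IHk (ltnW lt_kd).
have lD : last w p \in D by apply/pD/mem_last.
have [z] : exists z, z \in [set y in D | e (last w p) y] :\: [set y in belast w p].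
  apply/card_gt0P; rewrite cardsD subn_gt0 (leq_trans _ (degD _ lD)) //.
  apply: leq_ltn_trans (subset_leq_card (subsetIr _ _)) _.
  by rewrite cardsE (leq_ltn_trans (card_size _)) // size_belast sp.
rewrite !inE => /andP[zNb /andP[zD ez]].
exists (rcons p z); split.
- by rewrite rcons_path ep.
- rewrite -rcons_cons rcons_uniq up andbT lastI mem_rcons inE negb_or zNb andbT.
  by apply: contraTneq ez => ->; rewrite e_irr.
- by move=> x; rewrite -rcons_cons mem_rcons inE => /predU1P[->|/pD].
- by rewrite size_rcons sp.
Qed.

Let inpath (D : {set T}) s := [&& sorted e s, uniq s & all (mem D) s].

Lemma longest_path (D : {set T}) (w : T) : w \in D ->
  exists2 s, inpath D s & forall s', inpath D s' -> size s' <= size s.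
Proof.
move=> wD; pose P n := [exists t : n.-tuple T, inpath D t].
have PE s : inpath D s -> P (size s) by move=> Ds; apply/existsP; exists (in_tuple s).
have exP : exists n, P n by exists 1; apply: (PE [:: w]); rewrite /inpath /= wD.
have ubP n : P n -> n <= #|T|.
  case/existsP=> t /and3P[_ ut _]; rewrite -(size_tuple t) -(card_uniqP ut).
  exact: max_card.
case: (ex_maxnP exP ubP) => n /existsP[t Dt] max_n.
by exists t => // s' /PE /max_n; rewrite size_tuple.
Qed.

(* Posa rotation: crossing chords at the two ends close a path into a cycle. *)
Lemma cycle_of_crossing (x z : T) (p q : seq T) :
    path e x (p ++ z :: q) -> e x z -> e (last z q) (last x p) ->
  cycle e (x :: p ++ rev (z :: q)).
Proof.
rewrite cat_path /= => /and3P[ep _ eq] exz elast.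
rewrite rcons_cat cat_path ep /=.
have e_lz : last (last z q) (rev (belast z q)) = z.
  by case: q {eq elast} => //= u q; rewrite rev_cons last_rcons.
rewrite lastI rev_rcons /= e_sym elast rcons_path e_lz e_sym exz andbT.
by rewrite rev_path (eq_path (e' := e)).
Qed.

(** A longest path on at least [2 * d] vertices is cut in two. A shorter one closes into a cycle on
    the same vertices; by maximality no edge leaves it, so the rest of [D] keeps minimum degree [d]
    and the second path is grown there greedily. *)
Lemma two_paths (D : {set T}) (d : nat) : 0 < d -> 2 * d <= #|D| ->
    {in D, forall x, d <= #|[set y in D | e x y]|} ->
  exists x p y q, [/\ path e x p, path e y q, uniq ((x :: p) ++ (y :: q)),
    {subset (x :: p) ++ (y :: q) <= D} & d <= (size p).+1 /\ d <= (size q).+1].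
Proof.
move=> d_gt0 leD degD.
have [w0 w0D] : exists w, w \in D by apply/card_gt0P; lia.
have [s] := longest_path w0D.
case: s => [|x p].
  by move=> _ /(_ [:: w0]); rewrite /inpath /= w0D => /(_ isT).
case/and3P=> ep up /allP pD pmax.
case: (leqP (2 * d) (size p).+1) => [le_p|lt_p].
  have lt_dp : d.-1 < size p by lia.
  move: ep up pD; rewrite -(cat_take_drop d.-1 p).
  rewrite (drop_nth x lt_dp) /= cat_path /= => /and3P[ep _ eq] up pD.
  exists x, (take d.-1 p), (nth x p d.-1), (drop d.-1.+1 p); split=> //.
  by rewrite size_takel ?size_drop //; lia.
have maxI s' : inpath D s' -> size s' <= (size p).+1 by exact: pmax.
have xD : x \in D by apply: pD; rewrite mem_head.
have lD : last x p \in D by apply/pD/mem_last.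
have epx : path e x p by [].
have /andP[xNp upp] : (x \notin p) && uniq p by [].
have nbx z : z \in D -> e x z -> z \in p.
  move=> zD exz; have zNx : z != x by apply: contraTneq exz => ->; rewrite e_irr.
  apply: contraT => zNp; suff /maxI /= : inpath D (z :: x :: p) by rewrite ltnn.
  rewrite /inpath /= e_sym exz epx inE negb_or zNx zNp zD xD xNp upp /=.
  by apply/allP=> u up'; apply: pD; rewrite inE up' orbT.
have nby z : z \in D -> e (last x p) z -> z \in belast x p.
  move=> zD ez; have zNl : z != last x p by apply: contraTneq ez => ->; rewrite e_irr.
  apply: contraT => zNp; suff /maxI : inpath D (rcons (x :: p) z).
    by rewrite size_rcons /= ltnn.
  apply/and3P; split.
  - by rewrite /= rcons_path epx ez.
  - by rewrite rcons_uniq up andbT lastI mem_rcons inE negb_or zNl zNp.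
  - by apply/allP=> u; rewrite mem_rcons inE => /predU1P[->|/pD].
(* By maximality both ends have all their neighbours on the path. Each end gives [d] positions among
   fewer than [2 * d], so some consecutive pair carries crossing chords. *)
have [i [lt_i exi eyi]] : exists i, [/\ i < size p, e x (nth x p i)
    & e (last x p) (nth x (x :: p) i)].
  pose I := [set i : 'I_(size p) | e x (nth x p i)].
  pose J := [set i : 'I_(size p) | e (last x p) (nth x (x :: p) i)].
  have leI : d <= #|I|.
    apply: leq_trans (degD x xD) (leq_trans _ (leq_imset_card (fun i : 'I_ _ => nth x p i) _)).
    apply/subset_leq_card/subsetP=> z; rewrite inE => /andP[zD exz].
    have zp := nbx z zD exz; have lti : index z p < size p by rewrite index_mem.
    by apply/imsetP; exists (Ordinal lti); rewrite ?inE /= nth_index.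
  have leJ : d <= #|J|.
    apply: leq_trans (degD _ lD) (leq_trans _ (leq_imset_card (fun i : 'I_ _ => nth x (x :: p) i) _)).
    apply/subset_leq_card/subsetP=> z; rewrite inE => /andP[zD exz].
    have zp := nby z zD exz.
    have lti : index z (belast x p) < size p by rewrite -[X in _ < X](size_belast x) index_mem.
    have ez : nth x (x :: p) (index z (belast x p)) = z.
      by rewrite lastI nth_rcons size_belast lti nth_index.
    by apply/imsetP; exists (Ordinal lti); rewrite ?inE /= ez.
  have : 0 < #|I :&: J|.
    have := cardsUI I J; have : #|I :|: J| <= size p by rewrite -[leqRHS]card_ord max_card.
    lia.
  by case/card_gt0P=> i; rewrite !inE => /andP[? ?]; exists i; split.
pose c := x :: take i p ++ rev (drop i p).
have pE : p = take i p ++ nth x p i :: drop i.+1 p.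
  by rewrite -drop_nth // cat_take_drop.
have ec : cycle e c.
  rewrite /c (drop_nth x lt_i); apply: cycle_of_crossing => //.
    by rewrite -pE.
  have -> : last (nth x p i) (drop i.+1 p) = last x p by rewrite {3}pE last_cat.
  suff -> : last x (take i p) = nth x (x :: p) i by [].
  rewrite -nth_last size_takel 1?ltnW //.
  by case: (i) lt_i => [|j] lt_j; [rewrite take0 | rewrite nth_take /=].
have pc : perm_eq c (x :: p).
  by rewrite perm_cons -[X in perm_eq _ X](cat_take_drop i) perm_cat2l perm_rev.
have uc : uniq c by rewrite (perm_uniq pc).
have sc : size c = (size p).+1 by rewrite (perm_size pc).
(* A neighbour outside the cycle, followed by the cycle cut open at [u], would be a longer path. *)
have closed_c u w : u \in c -> w \in D -> e u w -> w \in c.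
  move=> uc' wD euw; apply: contraT => wNc.
  have [k c' ec'] := rot_to uc'.
  have : cycle e (u :: c') by rewrite -ec' rot_cycle.
  rewrite /= rcons_path => /andP[euc _].
  suff /maxI : inpath D (w :: u :: c') by rewrite -ec' /= size_rot sc ltnn.
  apply/and3P; split.
  - by rewrite /= e_sym euw.
  - by rewrite cons_uniq -ec' mem_rot wNc rot_uniq.
  - apply/allP=> z; rewrite inE => /predU1P[->//|].
    by rewrite -ec' mem_rot (perm_mem pc); apply: pD.
pose D' := D :\: [set y in c].
have [w wD'] : exists w, w \in D'.
  apply/card_gt0P; rewrite /D' cardsD subn_gt0 (leq_ltn_trans _ (leq_trans lt_p leD)) //.
  rewrite (leq_trans (subset_leq_card (subsetIr _ _))) // cardsE.
  by rewrite (leq_trans (card_size _)) ?sc.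
have degD' : {in D', forall u, d <= #|[set y in D' | e u y]|}.
  move=> u; rewrite !inE => /andP[uNc uD]; apply: leq_trans (degD u uD) _.
  apply/subset_leq_card/subsetP=> y; rewrite !inE => /andP[yD euy].
  rewrite yD euy !andbT; apply: contra uNc => yc.
  by apply: closed_c yc uD _; rewrite e_sym.
have [q [eq uq qD sq]] := greedy_path wD' degD'.
exists x, p, w, q; split=> //.
- rewrite cat_uniq; apply/and3P; split=> //; apply/hasPn=> z /qD.
  by rewrite in_setD in_set (perm_mem pc) => /andP[].
- by move=> z; rewrite mem_cat => /orP[/pD//|/qD]; rewrite inE => /andP[].
split; last by rewrite sq.
(* The first path is long enough because it contains every neighbour of its start. *)
have := degD x xD; rewrite leqNgt => dx; apply: contraNleq dx => ltd.
apply: leq_ltn_trans (subset_leq_card (B := [set y in p]) _) _.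
  by apply/subsetP=> z; rewrite !inE => /andP[]; apply: nbx.
by rewrite cardsE (leq_ltn_trans (card_size _)) // ltnW.
Qed.

End TwoPaths.

(** * Hitting sets *)

Section HittingSets.

Variables (T I : finType).
Implicit Types (F : I -> {set T}) (R : {set T}).

Lemma double_count (J : {set I}) F :
  \sum_(x : T) #|[set i in J | x \in F i]| = \sum_(i in J) #|F i|.
Proof.
under eq_bigr do rewrite -sum1_card.
under [RHS]eq_bigr do rewrite -sum1_card.
rewrite (exchange_big_dep (fun i => i \in J)) /=; last by move=> x i _; rewrite inE => /andP[].
by apply: eq_bigr => i iJ; apply: eq_bigl => x; rewrite inE iJ.
Qed.

(** Averaging: the incidences number at least [#|J| * sigma], spread over at most [M * sigma]
    points. *)
Lemma popular_point F (J : {set I}) (M sigma : nat) :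
    0 < sigma -> #|T| <= M * sigma -> (forall i, sigma <= #|F i|) -> J != set0 ->
  exists x, #|J| <= M * #|[set i in J | x \in F i]|.
Proof.
move=> s0 leT geF /set0Pn[j jJ].
have cJ : 0 < #|J| by apply/card_gt0P; exists j.
case: (boolP [exists x, #|J| <= M * #|[set i in J | x \in F i]|]) => [/existsP//|].
rewrite negb_exists => /forallP H.
have le1 : #|J| * sigma <= \sum_(x : T) #|[set i in J | x \in F i]|.
  by rewrite double_count -sum_nat_const leq_sum.
have le2 : M * \sum_(x : T) #|[set i in J | x \in F i]| <= #|T| * #|J|.-1.
  rewrite big_distrr /= -sum_nat_const; apply: leq_sum => x _.
  by have := H x; rewrite -ltnNge -[X in _ < X](prednK cJ) ltnS.
have T0 : 0 < #|T|.
  exact: leq_trans (leq_trans s0 (geF j)) (max_card _).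
have : #|T| * #|J| <= #|T| * #|J|.-1.
  apply: leq_trans le2; apply: leq_trans (leq_mul (leqnn M) le1).
  by rewrite mulnCA mulnC leq_mul2l leT orbT.
by rewrite leq_mul2l leqNgt ltn_predL cJ orbF; move: T0; case: #|T|.
Qed.

(** The first two terms of the binomial expansion suffice. This is the estimate (1 - 1/M)^M <= 1/2
    with [M = p.+1]. *)
Lemma pow_succ_double (p : nat) : 2 * p ^ p.+1 <= p.+1 ^ p.+1.
Proof.
suff H k : p ^ k + k * p ^ k.-1 <= p.+1 ^ k.
  by apply: leq_trans (H p.+1) => /=; rewrite mul2n -addnn leq_add2l expnS leq_mul2r leqnSn orbT.
elim: k => [|k IHk]; first by rewrite expn0.
rewrite [leqRHS]expnS; apply: leq_trans (leq_mul (leqnn p.+1) IHk).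
case: k {IHk} => [|k] /=; first by rewrite expn0 expn1; lia.
by rewrite !expnS; nia.
Qed.

(* Greedily adding a most popular point leaves a fraction 1 - 1/M of the sets unhit at each step. *)
Lemma hitting_set F (M sigma k : nat) :
    0 < sigma -> #|T| <= M * sigma -> (forall i, sigma <= #|F i|) -> #|I| < 2 ^ k ->
  exists2 R : {set T}, #|R| <= M * k & forall i, F i :&: R != set0.
Proof.
move=> s0 leT geF ltI.
pose unhit (R : {set T}) := [set i | F i :&: R == set0].
have greedy r : exists2 R : {set T}, #|R| <= r & M ^ r * #|unhit R| <= M.-1 ^ r * #|I|.
  elim: r => [|r [R leR IHr]].
    by exists set0; rewrite ?cards0 // !expn0 !mul1n max_card.
  have [u0|/(popular_point s0 leT geF)[x px]] := eqVneq (unhit R) set0.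
    by exists R; rewrite ?u0 ?cards0 ?muln0 // (leq_trans leR).
  exists (x |: R); first by rewrite cardsU1 (leq_trans (leq_add (leq_b1 _) leR)).
  have le1 : M * #|unhit (x |: R)| <= M.-1 * #|unhit R|.
    have -> : #|unhit (x |: R)| = #|unhit R| - #|[set i in unhit R | x \in F i]|.
      have <- := cardsID [set i | x \in F i] (unhit R).
      have -> : [set i in unhit R | x \in F i] = unhit R :&: [set i | x \in F i].
        by apply/setP=> i; rewrite !inE.
      rewrite addKn; apply: eq_card => i; rewrite !inE setIUr setU_eq0 andbC.
      rewrite [RHS]andbC; congr (_ && _).
      by apply/eqP/idP => [/setP/(_ x)|xNF]; [rewrite !inE eqxx andbT => -> |
        apply/setP=> y; rewrite !inE; apply/andP=> -[yF /eqP yx]; rewrite -yx yF in xNF].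
    by rewrite mulnBr; case: (M) px => [|M'] px //=; rewrite mulSn; lia.
  rewrite expnSr -mulnA; apply: leq_trans (leq_mul (leqnn _) le1) _.
  by rewrite mulnCA expnS -mulnA leq_mul2l IHr orbT.
(* After [M * k] rounds the unhit fraction is at most (1 - 1/M)^(Mk) <= 2^(-k), which leaves less
   than one set. *)
have [R leR le1] := greedy (M * k); exists R => // i.
have M0 : 0 < M.
  have := leq_trans (leq_trans s0 (geF i)) (leq_trans (max_card _) leT).
  by case: (M).
apply/eqP=> Fi; have u0 : 0 < #|unhit R| by apply/card_gt0P; exists i; rewrite inE Fi.
have k0 : 0 < k.
  by case: k ltI {le1 leR} => //; rewrite ltnS leqn0 => /eqP/card0_eq/(_ i).
have le2 : 2 ^ k * M.-1 ^ (M * k) <= M ^ (M * k).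
  by rewrite !expnM -expnMn; rewrite leq_exp2r //; case: (M) M0 => // p _; exact: pow_succ_double.
have : 2 ^ k * M.-1 ^ (M * k) <= M.-1 ^ (M * k) * #|I|.
  by apply: leq_trans le2 (leq_trans _ le1); rewrite -{1}[M ^ _]muln1 leq_mul2l u0 orbT.
rewrite mulnC leq_mul2l [2 ^ k <= _]leqNgt ltI orbF expn_eq0 => /andP[/eqP p0 _].
move: le1; rewrite p0 exp0n; last by rewrite muln_gt0 M0.
by rewrite mul0n leqn0 muln_eq0 expn_eq0 (gtn_eqF M0) (gtn_eqF u0).
Qed.

(** [g] rounds of [hitting_set], each applied to the sets without [Y] and the points already chosen,
    so that every round contributes a new point to each set. *)
Lemma reservoir F (Y : {set T}) (M sigma k g : nat) :
    0 < sigma -> #|T| <= M * sigma -> #|I| < 2 ^ k ->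
    (forall i, sigma + g * (M * k) + #|Y| <= #|F i|) ->
  exists R : {set T}, [/\ #|R| <= g * (M * k), [disjoint R & Y] & forall i, g <= #|F i :&: R|].
Proof.
move=> s0 leT ltI.
elim: g => [|g IHg] geF.
  by exists set0; rewrite cards0 disjoints_subset sub0set.
have [i|R [leR dRY geR]] := IHg.
  by apply: leq_trans (geF i); rewrite leq_add2r leq_add2l leq_mul2r leqnSn orbT.
have [i|R' leR' hitR'] := @hitting_set (fun i => F i :\: (R :|: Y)) M sigma k s0 leT _ ltI.
  rewrite cardsD leq_subRL.
    rewrite addnC (leq_trans _ (geF i)) // -addnA leq_add2l.
    rewrite (leq_trans (subset_leq_card (subsetIr _ _))) //.
    by rewrite (leq_trans (leq_card_setU _ _)) // leq_add2r (leq_trans leR) // leq_mul2r leqnSn orbT.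
  by rewrite subset_leq_card // subsetIl.
exists (R :|: R' :\: Y); split.
- rewrite (leq_trans (leq_card_setU _ _)) // mulSn addnC leq_add //.
  by rewrite (leq_trans (subset_leq_card (subsetDl _ _))).
- rewrite disjoints_subset subUset -disjoints_subset dRY /=.
  by apply/subsetP=> x; rewrite !inE => /andP[].
move=> i; have /set0Pn[x] := hitR' i; rewrite !inE negb_or => /andP[/andP[/andP[xNR xNY] xF] xR'].
have : #|x |: (F i :&: R)| <= #|F i :&: (R :|: R' :\: Y)|.
  apply/subset_leq_card/subsetP=> y; rewrite !inE => /predU1P[->|/andP[-> ->]] //.
  by rewrite xF xNY xR' orbT.
by rewrite cardsU1 !inE (negPf xNR) andbF; apply: leq_trans; rewrite add1n ltnS.
Qed.

End HittingSets.

(** This supplies the exponent of [hitting_set]: [2 ^ k] must exceed the number of linked pairs,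
    quadratic in the threshold [t], while a reservoir of size proportional to [k] must stay small
    against [t]. *)
Lemma exp_beats_quadratic (a c : nat) : exists t0, forall t, t0 <= t ->
  exists2 k, a * t ^ 2 < 2 ^ k & c * k <= t.
Proof.
pose C := 3 * c.+1; exists (C * (4 * a * C ^ 2).+1) => t le_t.
pose v := t %/ C; have C0 : 0 < C by [].
have le_v : 4 * a * C ^ 2 < v by rewrite leq_divRL // mulnC.
have t_le : t <= 2 * v * C.
  rewrite ltnW // (leq_trans (ltn_ceil t C0)) // leq_mul2r mul2n -addnn.
  by rewrite -addn1 leq_add2l (leq_ltn_trans _ le_v) // orbT.
(* With [v] of order [t / C], the quadratic is below [v ^ 3], and [v < 2 ^ v] is cubed. *)
exists (3 * v); last first.
  by apply: leq_trans (leq_divM t C); rewrite -/v /C; move: (v) => v'; nia.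
apply: (@leq_ltn_trans (v * v ^ 2)).
  apply: (@leq_trans (4 * a * C ^ 2 * v ^ 2)); last by rewrite leq_mul2r (ltnW le_v) orbT.
  have : t ^ 2 <= (2 * v * C) ^ 2 by rewrite leq_sqr.
  move/(leq_mul (leqnn a))/leq_trans; apply.
  suff -> : a * (2 * v * C) ^ 2 = 4 * a * C ^ 2 * v ^ 2 by [].
  by move: (v) (C) => v' C'; rewrite -!mulnn; lia.
by rewrite -expnS mulnC expnM ltn_exp2r // ltn_expl.
Qed.

(** * Link graphs and skeletons *)

Section Skeletons.

Variables (T : finType) (r : rel T).
Hypothesis r_sym : symmetric r.

Definition induced (A : {set T}) : rel T := fun x y => [&& x \in A, y \in A & r x y].

Lemma induced_sym A : symmetric (induced A).
Proof. by move=> x y; rewrite /induced r_sym andbCA. Qed.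

Lemma connect_inducedS (A B : {set T}) : A \subset B ->
  subrel (connect (induced A)) (connect (induced B)).
Proof.
move=> /subsetP sAB; apply: connect_sub => x y /and3P[xA yA rxy].
by rewrite connect1 // /induced !sAB.
Qed.

Definition independent (B : {set T}) := {in B &, forall x y, x != y -> ~~ r x y}.

Variable k : nat.
Hypothesis indep_card : forall B : {set T}, independent B -> #|B| <= k.

(** A maximal independent subset works, since an undominated vertex could be added to it. *)
Lemma dominating_independent (A : {set T}) : exists2 I : {set T}, I \subset A &
  #|I| <= k /\ {in A, forall x, exists2 h, h \in I & (h == x) || r h x}.
Proof.
pose P (B : {set T}) := (B \subset A) &&
  [forall x in B, forall y in B, (x != y) ==> ~~ r x y].
have [|I /maxsetP[/andP[sIA /forall_inP iI] maxI] _] := @maxset_exists T P set0.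
  by rewrite /P sub0set; apply/forall_inP=> x; rewrite inE.
have indI : independent I.
  by move=> x y xI yI; move/forall_inP: (iI x xI) => /(_ y yI)/implyP.
exists I => //; split; first exact: indep_card.
move=> x xA; case: (boolP [exists h in I, (h == x) || r h x]) => [/exists_inP[h hI hx]|].
  by exists h.
rewrite negb_exists_in => /forall_inP nI.
suff PxI : P (x |: I).
  by exists x; rewrite ?eqxx // -(maxI _ PxI (subsetUr _ _)) setU11.
rewrite /P subUset sub1set xA sIA.
apply/forall_inP=> u /setU1P[->|uI]; apply/forall_inP=> v /setU1P[->|vI].
- by rewrite eqxx.
- by rewrite r_sym; have := nI v vI; rewrite negb_or => /andP[_ ->]; rewrite implybT.
- by have := nI u uI; rewrite negb_or => /andP[_ ->]; rewrite implybT.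
- by apply/implyP/indI.
Qed.

(* A maximal independent set dominates A; hubs of the same component are linked
   through adjacent ones, i.e. hubs at distance at most 3, and two intermediate
   vertices suffice for each such pair. *)
Lemma skeleton (A : {set T}) : exists S : {set T}, [/\ S \subset A,
  #|S| <= k + 2 * k ^ 2 &
  {in A :\: S &, forall x y, connect (induced A) x y ->
     exists p, [/\ path r x (rcons p y), uniq p & {subset p <= S}]}].
Proof.
have [I sIA [cI domI]] := dominating_independent A.
pose r' : rel T := fun x y => (x == y) || r x y.
pose wit (u : T * T) (v : T * T) :=
  [&& v.1 \in A, v.2 \in A, r' u.1 v.1, r' v.1 v.2 & r' v.2 u.2].
(* The default [u] keeps both coordinates in [A] when two hubs have no connecting pair. *)
pose mid u : T * T := odflt u [pick v | wit u v].
have midA u : u.1 \in A -> u.2 \in A -> ((mid u).1 \in A) /\ ((mid u).2 \in A).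
  by move=> ? ?; rewrite /mid; case: pickP => [v /and5P[]|] //=.
pose S := I :|: [set (mid u).1 | u in setX I I] :|: [set (mid u).2 | u in setX I I].
have sSA : S \subset A.
  have IA := subsetP sIA; rewrite !subUset sIA /=.
  by apply/andP; split; apply/subsetP=> x /imsetP[[h h'] /setXP[/IA hA /IA hA'] ->];
    have [] := midA (h, h') hA hA'.
have cS : #|S| <= k + 2 * k ^ 2.
  rewrite (leq_trans (leq_card_setU _ _)) // mul2n -addnn addnA leq_add //.
    rewrite (leq_trans (leq_card_setU _ _)) // leq_add //.
    by rewrite (leq_trans (leq_imset_card _ _)) // cardsX -mulnn leq_mul.
  by rewrite (leq_trans (leq_imset_card _ _)) // cardsX -mulnn leq_mul.
have IS h : h \in I -> h \in S by rewrite !inE => ->.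
have step x y : x \in S -> y \in S -> r' x y -> connect (induced S) x y.
  by move=> xS yS /predU1P[->//|rxy]; rewrite connect1 // /induced xS yS.
have hub2 h h' x y : h \in I -> h' \in I -> x \in A -> y \in A ->
    r' h x -> r' x y -> r' y h' -> connect (induced S) h h'.
  move=> hI h'I xA yA hx xy yh'.
  have uI : (h, h') \in setX I I by apply/setXP.
  have : wit (h, h') (mid (h, h')).
    rewrite /mid; case: pickP => [//|/(_ (x, y))].
    by rewrite /wit /= xA yA hx xy yh'.
  have m1 : (mid (h, h')).1 \in S.
    by rewrite !inE (imset_f (fun u => (mid u).1)) ?orbT.
  have m2 : (mid (h, h')).2 \in S.
    by rewrite !inE (imset_f (fun u => (mid u).2)) ?orbT.
  case/and5P=> _ _ r1 r2 r3; apply: connect_trans (step _ _ (IS _ hI) m1 r1) _.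
  exact: connect_trans (step _ _ m1 m2 r2) (step _ _ m2 (IS _ h'I) r3).
have r'_sym : symmetric r' by move=> x y; rewrite /r' eq_sym r_sym.
(* Along a link path each vertex is replaced by a hub dominating it; hubs of consecutive vertices
   are at distance at most 3. *)
have hubs x p h h' : x \in A -> h \in I -> h' \in I -> path (induced A) x p ->
    r' h x -> r' (last x p) h' -> connect (induced S) h h'.
  elim: p x h => [|z p IHp] x h xA hI h'I /=.
    by move=> _ hx xh'; apply: (hub2 h h' x x); rewrite // /r' eqxx.
  case/andP=> /and3P[_ zA rxz] ep hx lh'.
  have [h1 h1I h1z] := domI z zA.
  apply: connect_trans (IHp z h1 zA h1I h'I ep h1z lh').
  by apply: (hub2 h h1 x z) => //; [rewrite /r' rxz orbT | rewrite r'_sym].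
exists S; split=> // x y; rewrite !in_setD => /andP[xNS xA] /andP[yNS yA].
case/connectP=> q eq ey.
have [h hI hx] := domI x xA; have [h' h'I h'y] := domI y yA.
have : connect (induced S) h h'.
  by apply: (hubs x q) => //; rewrite -ey r'_sym.
case/connectP=> p0 ep0 eh'; case: (shortenP ep0) eh' => p ep up _ eh'.
have rhx : r h x by case/predU1P: hx => // hx; rewrite -hx (IS _ hI) in xNS.
have rhy : r h' y by case/predU1P: h'y => // hy; rewrite -hy (IS _ h'I) in yNS.
exists (h :: p); split=> //.
  rewrite rcons_cons /= r_sym rhx rcons_path -eh' rhy andbT.
  by apply: sub_path ep => u v /and3P[].
move=> z; rewrite inE => /predU1P[->|zp]; first exact: IS.
by elim: p (h) ep zp {up eh'} => //= u p IHp v /andP[/and3P[_ uS _] ep];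
  rewrite inE => /predU1P[->|/(IHp u ep)].
Qed.

End Skeletons.

(** * Expanding link paths into paths of the graph *)

Section Expansion.

Variables (T : finType) (e r : rel T) (R : {set T}) (g : nat).
Hypotheses (e_sym : symmetric e)
  (r_common : forall x y, r x y -> g <= #|[set z in R | e x z && e y z]|).

(** Each link is subdivided by a fresh common neighbour from [R]. [W] holds the forbidden vertices
    and grows along the induction, which keeps the chosen ones distinct. *)
Lemma expand_path (x : T) (p : seq T) (W : {set T}) :
    path r x p -> #|W| + size p <= g ->
  exists w rs, [/\ path e x w, last x w = last x p, perm_eq w (rs ++ p) &
    [/\ uniq rs, {subset rs <= R :\: W} & size rs = size p]].
Proof.
elim: p x W => [|y p IHp] x W; first by move=> _ _; exists [::], [::].
case/andP=> rxy rp; rewrite /= addnS => leW.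
have /set0Pn[z] : [set z in R | e x z && e y z] :\: W != set0.
  rewrite -card_gt0 cardsD subn_gt0; apply: leq_trans (r_common rxy).
  rewrite (leq_ltn_trans (subset_leq_card (subsetIr _ _))) //.
  by rewrite (leq_trans _ leW) // ltnS leq_addr.
rewrite !inE => /and3P[zNW zR /andP[xz yz]].
have [|w [rs [ew lw pw [urs sub srs]]]] := IHp y (z |: W) rp.
  by rewrite cardsU1 zNW.
exists [:: z, y & w], (z :: rs); split=> //=.
- by rewrite xz e_sym yz.
- rewrite perm_cons -[y :: w]cat1s -[y :: p]cat1s perm_sym perm_catCA perm_sym.
  by rewrite perm_cat2l.
split; last by rewrite srs.
  by rewrite urs andbT; apply/negP=> /sub; rewrite !inE eqxx.
move=> u; rewrite inE => /predU1P[->|/sub]; first by rewrite !inE zNW.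
by rewrite !inE negb_or => /andP[/andP[_ ->] ->].
Qed.

End Expansion.

(** * The link graph of common neighbourhoods *)

Section CommonNeighbours.

Variables (T : finType) (e : rel T).

Definition nbhd (x : T) := [set y | e x y].

Variable tau : nat.

Definition linked : rel T := fun x y => (x != y) && (tau <= #|nbhd x :&: nbhd y|).

Lemma linked_sym : symmetric linked.
Proof. by move=> x y; rewrite /linked eq_sym setIC. Qed.

Lemma card_cap_bigcup (A : {set T}) (l : seq T) :
    {in l, forall y, #|A :&: nbhd y| <= tau} ->
  #|A :&: \bigcup_(y <- l) nbhd y| <= size l * tau.
Proof.
elim: l => [|y l IHl] le_tau; first by rewrite big_nil setI0 cards0.
rewrite big_cons setIUr (leq_trans (leq_card_setU _ _)) // mulSn leq_add //.
  by rewrite le_tau ?mem_head.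
by apply: IHl => z zl; rewrite le_tau // inE zl orbT.
Qed.

(** By inclusion-exclusion, [2 * K + 1] neighbourhoods of size at least [s] with pairwise overlaps
    below [tau] lose at most half of their total size, so they would cover more than [K * s]
    vertices. *)
Lemma independent_linked_card (K s : nat) (B : {set T}) :
    0 < s -> 4 * K * tau <= s -> #|T| <= K * s -> (forall x, s <= #|nbhd x|) ->
  independent linked B -> #|B| <= 2 * K.
Proof.
move=> s0 le_s leT deg indB; rewrite leqNgt; apply/negP=> ltB.
have union (l : seq T) : uniq l -> {subset l <= B} -> size l <= (2 * K).+1 ->
    size l * s <= #|\bigcup_(y <- l) nbhd y| + size l * (2 * K * tau).
  elim: l => [|x l IHl] //= /andP[xNl ul] slB lel.
  have {}IHl := IHl ul (fun z zl => slB z (mem_behead (s := x :: l) zl)) (ltnW lel).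
  have capx : #|nbhd x :&: \bigcup_(y <- l) nbhd y| <= 2 * K * tau.
    apply: leq_trans (card_cap_bigcup _) _; last by rewrite leq_mul2r (ltnSE lel) orbT.
    move=> y yl; have xy : x != y by apply: contraNneq xNl => ->.
    have xB := slB x (mem_head x l); have yB := slB y (mem_behead (s := x :: l) yl).
    by have := indB x y xB yB xy; rewrite /linked xy -ltnNge => /ltnW.
  rewrite big_cons !mulSn; have := cardsUI (nbhd x) (\bigcup_(y <- l) nbhd y).
  have := deg x; lia.
pose l := take (2 * K).+1 (enum B).
have sl : size l = (2 * K).+1 by rewrite size_takel // -cardE.
have := @union l (take_uniq _ (enum_uniq _)) _; rewrite sl leqnn.
have sub : {subset l <= B} by move=> z /mem_take; rewrite mem_enum.
move=> /(_ sub isT); have : #|\bigcup_(y <- l) nbhd y| <= K * s.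
  exact: leq_trans (max_card _) leT.
have := leq_mul (leqnn (2 * K).+1) le_s; nia.
Qed.

End CommonNeighbours.

(** * Link components *)

Section Classes.

Variables (T : finType) (e : rel T) (tau k : nat) (A : {set T}).
Hypotheses (e_sym : symmetric e)
  (indep_card : forall B : {set T}, independent (linked e tau) B -> #|B| <= k).

(** A link component of [A] is encoded by its canonical representative, so labels of components are
    vertices. *)
Definition class (x : T) := fingraph.root (induced (linked e tau) A) x.

Let ind_sym : connect_sym (induced (linked e tau) A).
Proof. exact/sym_connect_sym/induced_sym/linked_sym. Qed.

Lemma eq_class x y : (class x == class y) = connect (induced (linked e tau) A) x y.
Proof. exact: fingraph.root_connect. Qed.

Lemma class_mem x : x \in A -> class x \in A.
Proof.
move=> xA; have : connect (induced (linked e tau) A) x (class x) by apply: connect_root.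
case/connectP=> p ep ->; elim: p x xA ep => //= y p IHp x _ /andP[/and3P[_ yA _]].
exact: IHp.
Qed.

Definition labels := [set class x | x in A].

(** Representatives of distinct components are never linked, so they form an independent set. *)
Lemma card_labels : #|labels| <= k.
Proof.
apply: indep_card => _ _ /imsetP[x xA ->] /imsetP[y yA ->]; apply: contraNN => rxy.
have : connect (induced (linked e tau) A) (class x) (class y).
  by rewrite connect1 // /induced !class_mem.
by rewrite -eq_class /class !fingraph.root_root.
Qed.

Definition nbhd_in (x l : T) := [set y in A | e x y && (class y == l)].

Variable theta : nat.

Definition split_vertices := [set x | [exists l, exists l',
  [&& l != l', theta <= #|nbhd_in x l| & theta <= #|nbhd_in x l'|]]].

(* Pairs of vertices in different classes are not linked, hence have fewer than
   [tau] common neighbours; double counting leaves few split vertices. *)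
Lemma card_split_vertices : #|split_vertices| * theta ^ 2 <= #|T| ^ 2 * tau.
Proof.
pose J := [set u : T * T | [&& u.1 \in A, u.2 \in A & class u.1 != class u.2]].
pose F (u : T * T) := nbhd e u.1 :&: nbhd e u.2.
have := double_count J F => dc.
apply: (@leq_trans (\sum_x #|[set u in J | x \in F u]|)).
  rewrite -sum_nat_const [leqRHS](bigID (mem split_vertices)) /= -[leqLHS]addn0.
  apply: leq_add => //; apply: leq_sum => x; rewrite inE.
  case/existsP=> l /existsP[l' /and3P[ll' le_l le_l']].
  apply: (@leq_trans #|setX (nbhd_in x l) (nbhd_in x l')|).
    by rewrite cardsX -mulnn leq_mul.
  apply/subset_leq_card/subsetP=> -[y y'] /setXP[].
  rewrite !inE /= => /and3P[-> ey /eqP cy] /and3P[-> ey' /eqP cy'].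
  by rewrite cy cy' ll' (e_sym y) (e_sym y') ey ey'.
rewrite dc; apply: (@leq_trans (\sum_(u in J) tau)).
  apply: leq_sum => -[x y]; rewrite inE /= => /and3P[xA yA]; apply: contraNleq => /ltnW le_tau.
  have [->//|xy] := eqVneq x y.
  by rewrite eq_class connect1 // /induced xA yA /linked xy.
rewrite sum_nat_const leq_mul2r -mulnn -card_prod; apply/orP; right.
exact: max_card.
Qed.

Definition major (x : T) := [arg max_(l > x) #|nbhd_in x l|].

(** Off the split vertices at most one class receives [theta] neighbours, so every class but the
    majority one receives fewer, and there are at most [k] classes. *)
Lemma minor_nbrs x : x \notin split_vertices ->
  #|[set y in A | e x y && (class y != major x)]| <= k * theta.
Proof.
rewrite inE negb_exists => /forallP/(_ (major x)); rewrite negb_exists => /forallP small.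
have smallP l : l != major x -> #|nbhd_in x l| <= theta.
  rewrite eq_sym => lx; have := small l; rewrite lx /=.
  rewrite /major; case: arg_maxnP => // l0 _ max_l0.
  rewrite negb_and -!ltnNge => /orP[lt0|/ltnW//].
  by apply/ltnW/(leq_ltn_trans (max_l0 l isT)).
have -> : [set y in A | e x y && (class y != major x)] =
    \bigcup_(l in labels :\ major x) nbhd_in x l.
  apply/setP=> y; rewrite inE; apply/idP/bigcupP => [/and3P[yA exy cy]|[l]].
    by exists (class y); rewrite !inE ?cy ?imset_f // yA exy eqxx.
  by rewrite !inE => /andP[lx _] /and3P[-> -> /eqP->].
apply: (@leq_trans (\sum_(l in labels :\ major x) #|nbhd_in x l|)).
  elim/big_rec2: _ => [|l n U _ le_U]; first by rewrite cards0.
  by rewrite (leq_trans (leq_card_setU _ _)) // leq_add2l.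
apply: (@leq_trans (\sum_(l in labels :\ major x) theta)).
  by apply: leq_sum => l; rewrite !inE => /andP[lx _]; apply: smallP.
rewrite sum_nat_const leq_mul2r (leq_trans _ card_labels) ?orbT //.
by rewrite subset_leq_card // subsetDl.
Qed.

(* Both ends of a coherent edge see it as going to their majority class, so classes
   alternate along coherent paths even when a class meets several parts. *)
Definition coherent : rel T := fun x y =>
  [&& e x y, class y == major x & class x == major y].

Lemma coherent_sym : symmetric coherent.
Proof. by move=> x y; rewrite /coherent e_sym [(class y == _) && _]andbC. Qed.

Let W := A :\: split_vertices.

Definition incoherent_nbrs x := [set y in W | e x y && ~~ coherent x y].

(** An incoherent edge is a minority edge for one of its ends. The two cases are exchanged by
    reversing edges, hence the factor 2. *)
Lemma sum_incoherent : \sum_(x in W) #|incoherent_nbrs x| <= 2 * (#|T| * (k * theta)).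
Proof.
pose P x := [set y in A | e x y && (class y != major x)].
pose Q x := [set y in W | e y x && (class x != major y)].
have sumP : \sum_(x in W) #|P x| <= #|T| * (k * theta).
  apply: (@leq_trans (\sum_(x in W) k * theta)).
    by apply: leq_sum => x /setDP[_ xW]; apply: minor_nbrs.
  by rewrite sum_nat_const leq_mul2r max_card orbT.
have sumQ : \sum_(x in W) #|Q x| <= #|T| * (k * theta).
  apply: leq_trans sumP.
  rewrite -(double_count W Q) [leqRHS](eq_bigr (fun x => #|[set y in P x]|)); last first.
    by move=> x _; rewrite cardsE.
  rewrite (bigID (mem W)) /= [X in _ + X]big1 ?addn0; last first.
    move=> x xW; apply/eqP; rewrite cards_eq0; apply/eqP/setP=> y.
    by rewrite in_set in_set0; apply/negP=> /andP[_]; rewrite in_set (negPf xW).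
  apply: leq_sum => x _; apply/subset_leq_card/subsetP=> y.
  by rewrite !inE => /andP[/andP[_ ->] /and3P[_ -> ->]].
rewrite mul2n -addnn; apply: leq_trans (leq_add sumP sumQ).
rewrite -big_split /=; apply: leq_sum => x _.
apply: leq_trans (leq_card_setU _ _); apply/subset_leq_card/subsetP=> y.
rewrite !inE /coherent => /andP[/andP[-> ->] /andP[exy]].
by rewrite exy e_sym exy /= negb_and.
Qed.

End Classes.

(** * Closing link walks into cycles of the graph *)

Section ClosedWalks.

Variables (T : finType) (e r : rel T) (R : {set T}) (g : nat).
Hypotheses (e_sym : symmetric e)
  (r_common : forall x y, r x y -> g <= #|[set z in R | e x z && e y z]|).

Lemma cycle_of_closed_path (x : T) (p : seq T) :
  path e x p -> last x p = x -> cycle e p.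
Proof. by case: p => //= y p /andP[exy ep] ex; rewrite rcons_path ep ex. Qed.

Lemma expand_cycle (x : T) (p : seq T) :
    path r x p -> last x p = x -> uniq p -> {in p, forall z, z \notin R} -> size p <= g ->
  exists c, [/\ cycle e c, uniq c & size c = 2 * size p].
Proof.
move=> rp px up pNR le_g.
have [|w [rs [ew lw pw [urs sub srs]]]] := expand_path e_sym r_common (W := set0) rp.
  by rewrite cards0.
exists w; split; first by apply: (cycle_of_closed_path ew); rewrite lw.
  rewrite (perm_uniq pw) cat_uniq urs up andbT /=.
  by apply/hasPn=> z /pNR; apply: contra => /sub; rewrite inE => /andP[].
by rewrite (perm_size pw) size_cat srs mul2n addnn.
Qed.

(** The two link paths have [size s1 + size s2 + 2] links in all, and each link becomes two edges.
    The vertices already used by the first expansion are forbidden to the second. *)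
Lemma assemble_cycle x1 p1 s1 x2 p2 s2 :
    path e x1 p1 -> path r (last x1 p1) (rcons s1 x2) ->
    path e x2 p2 -> path r (last x2 p2) (rcons s2 x1) ->
    uniq ((x1 :: p1) ++ (x2 :: p2) ++ s1 ++ s2) ->
    {in (x1 :: p1) ++ (x2 :: p2) ++ s1 ++ s2, forall z, z \notin R} ->
    size s1 + size s2 + 2 <= g ->
  exists c, [/\ cycle e c, uniq c &
    size c = size p1 + size p2 + 2 * (size s1 + size s2 + 2)].
Proof.
move=> ep1 rs1 ep2 rs2 uP PNR le_g.
have [|w1 [t1 [ew1 lw1 pw1 [ut1 sub1 st1]]]] :=
    expand_path e_sym r_common (W := set0) rs1.
  by rewrite cards0 size_rcons; lia.
have [|w2 [t2 [ew2 lw2 pw2 [ut2 sub2 st2]]]] :=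
    expand_path e_sym r_common (W := [set z in t1]) rs2.
  by rewrite cardsE (card_uniqP ut1) st1 !size_rcons; lia.
pose c := p1 ++ w1 ++ p2 ++ w2.
have pc : perm_eq c (((x1 :: p1) ++ (x2 :: p2) ++ s1 ++ s2) ++ (t1 ++ t2)).
  apply/permP=> a; rewrite /c !count_cat (permP pw1) (permP pw2).
  by rewrite !count_cat -!cats1 !count_cat /=; clear; lia.
rewrite !last_rcons in lw1 lw2.
exists c; split.
- apply: (@cycle_of_closed_path x1); last by rewrite /c !last_cat lw1 lw2.
  by rewrite /c !cat_path ep1 ew1 lw1 ep2 ew2.
- rewrite (perm_uniq pc) cat_uniq uP cat_uniq ut1 ut2 andbT /=.
  apply/andP; split; last first.
    by apply/hasPn=> z /sub2; rewrite !inE => /andP[].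
  apply/hasPn=> z; rewrite mem_cat => zt; apply/negP=> /PNR /negP; apply.
  by case/orP: zt => [/sub1|/sub2]; rewrite inE => /andP[].
- rewrite /c !size_cat (perm_size pw1) (perm_size pw2) !size_cat st1 st2 !size_rcons; clear; lia.
Qed.

End ClosedWalks.

(** * Parity of classes along coherent paths *)

Section CoherentPaths.

Variables (T : finType) (e : rel T) (tau : nat) (A : {set T}).
Let cl := class e tau A.
Let maj := major e tau A.
Let coh := coherent e tau A.

(** Both coherent neighbours of a vertex on the path lie in its majority class, so the class recurs
    every second step. *)
Lemma class_last_coherent x p : path coh x p -> ~~ odd (size p) -> cl (last x p) = cl x.
Proof.
elim: {p}_.+1 {-2}p x (ltnSn (size p)) => // n IHn [|y [|z p]] x //= le_n.
case/and3P=> /and3P[_ _ /eqP xy] /and3P[_ /eqP zy _] ep; rewrite negbK => odd_p.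
by rewrite IHn ?ltnS 1?ltnW // /cl zy -xy.
Qed.

(** If [i] is only the majority class of [x], dropping [x] makes the path start in class [i]; the
    strict bound on [h] leaves room for this. *)
Lemma trim_coherent (i x : T) (p : seq T) (h : nat) :
    path coh x p -> cl x = i \/ maj x = i -> 2 * h < size p ->
  exists x' p', [/\ path coh x' p', cl x' = i, cl (last x' p') = i, size p' = 2 * h
    & subseq (x' :: p') (x :: p)].
Proof.
have trim y q : path coh y q -> cl y = i -> 2 * h <= size q ->
    exists x' p', [/\ path coh x' p', cl x' = i, cl (last x' p') = i, size p' = 2 * h
      & subseq (x' :: p') (y :: q)].
  move=> eq cy le_h; exists y, (take (2 * h) q).
  have et : path coh y (take (2 * h) q) by move: eq; rewrite -{1}(cat_take_drop (2 * h) q) cat_path => /andP[].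
  have st : size (take (2 * h) q) = 2 * h by rewrite size_takel.
  split=> //; first by rewrite class_last_coherent // st mul2n odd_double.
  by rewrite /= eqxx take_subseq.
move=> ep [cx|mx] lt_h; first by apply: trim => //; apply: ltnW.
case: p ep lt_h => // y p /andP[/and3P[_ /eqP yx _] ep] lt_h.
have [||x' [p' [? ? ? ? sub]]] := trim y p ep; rewrite // ?/cl ?yx //.
exists x', p'; split=> //; apply: subseq_trans sub _.
exact: (subseq_cons (y :: p) x).
Qed.

End CoherentPaths.

(** * Closing up a cycle of prescribed length *)

(** Ramsey's theorem for the subgraph on [B], in which [k + 1] independent vertices are excluded. *)
Lemma clique_in_large_set (q k : nat) : exists M, forall (T : finType) (r : rel T) (B : {set T}),
    symmetric r -> (forall I : {set T}, independent r I -> #|I| <= k) -> M <= #|B| ->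
  exists Q : {set T}, [/\ Q \subset B, #|Q| = q & {in Q &, forall x y, x != y -> r x y}].
Proof.
have [M ramseyM] := ramsey_clique q k.+1; exists M => T r B r_sym indep leM.
pose r' : rel {x | x \in B} := fun x y => r (val x) (val y).
have r'_sym : symmetric r' by move=> x y; rewrite /r' r_sym.
have leM' : M <= #|[set: {x | x \in B}]|.
  by rewrite cardsT card_sig; rewrite (eq_card (B := mem B)).
have [[Q [cQ rQ]]|[I [cI rI]]] := ramseyM _ r' _ r'_sym leM'.
  exists [set val x | x in Q]; split.
  - by apply/subsetP=> _ /imsetP[x _ ->]; apply: valP.
  - by rewrite card_imset //; apply: val_inj.
  - move=> _ _ /imsetP[x xQ ->] /imsetP[y yQ ->] xy.
    by apply: rQ => //; apply: contraNneq xy => ->.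
suff : #|[set val x | x in I]| <= k by rewrite card_imset ?cI ?ltnn //; apply: val_inj.
apply: indep => _ _ /imsetP[x xI ->] /imsetP[y yI ->] xy.
by apply: rI => //; apply: contraNneq xy => ->.
Qed.

Lemma clique_path (T : eqType) (r : rel T) (x : T) (p : seq T) :
  {in x :: p &, forall y z, y != z -> r y z} -> uniq (x :: p) -> path r x p.
Proof.
elim: p x => //= y p IHp x rxy /and3P[xNp yNp up].
apply/andP; split.
  by apply: rxy; rewrite ?inE ?eqxx ?orbT //; apply: contraNneq xNp => ->; rewrite mem_head.
apply: IHp; last by rewrite /= yNp.
by move=> u v u_in v_in; apply: rxy; rewrite inE ?u_in ?v_in orbT.
Qed.

Section Closing.

Variables (T : finType) (e : rel T) (tau b : nat).
Hypotheses (e_sym : symmetric e) (e_irr : irreflexive e).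
Let r := linked e tau.

Definition linker (A S : {set T}) := [/\ S \subset A, #|S| <= b &
  {in A :\: S &, forall x y, connect (induced r A) x y ->
     exists p, [/\ path r x (rcons p y), uniq p & {subset p <= S}]}].

Variables (S1 S2 S3 Q R C : {set T}) (i : T).
Hypotheses (link1 : linker setT S1) (link2 : linker (~: S1) S2)
  (link3 : linker (~: (S1 :|: S2)) S3).
Let S0 := S1 :|: S2 :|: S3.
Let A := ~: S0.
Let cl := class e tau A.
Let coh := coherent e tau A.
Hypotheses (QA : Q \subset A) (clQ : {in Q, forall x, cl x = i})
  (Q_clique : {in Q &, forall x y, x != y -> r x y}) (cardQ : #|Q| = 3 * b + 4).
Hypotheses (R_disj : [disjoint R & S0 :|: Q])
  (r_common : forall x y, r x y -> 3 * b + 4 <= #|[set z in R | e x z && e y z]|).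
Hypotheses (CA : C \subset A) (C_disj : [disjoint C & R :|: Q])
  (clC : {in C, forall x, cl x = i \/ major e tau A x = i}).

(** Two coherent paths with ends in class [i] are joined through the skeletons. Clique vertices
    bring the number of links to exactly [3 * b + 4], whatever the lengths of the skeleton paths. *)
Lemma close_up (n : nat) : 3 * b + 4 <= n -> 2 * (n + 4) <= #|C| ->
    {in C, forall x, n + 4 <= #|[set y in C | coh x y]|} ->
  exists c, [/\ cycle e c, uniq c & size c = 2 * n].
Proof.
move=> le_n leC degC.
have coh_sym : symmetric coh by exact: coherent_sym.
have coh_irr : irreflexive coh by move=> x; rewrite /coh /coherent e_irr.
have [|x [p [y [p' [ep ep' upp' sub [lep lep']]]]]] := two_paths coh_sym coh_irr _ leC degC.
  by rewrite addnS.
(* The links account for [2 * (3 * b + 4)] edges; the rest is split evenly into two even lengths. *)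
pose h := (n - (3 * b + 4))./2; pose h' := n - (3 * b + 4) - h.
have eh : 2 * h + 2 * h' = 2 * (n - (3 * b + 4)) by rewrite /h' /h; lia.
have lt_h : 2 * h < size p by rewrite /h; lia.
have lt_h' : 2 * h' < size p' by rewrite /h' /h; lia.
have xC : x \in C by apply: sub; rewrite mem_cat mem_head.
have yC : y \in C by apply: sub; rewrite mem_cat mem_head orbT.
have [x1 [p1 [ep1 cx1 cl1 sp1 sub1]]] := trim_coherent ep (clC xC) lt_h.
have [x2 [p2 [ep2 cx2 cl2 sp2 sub2]]] := trim_coherent ep' (clC yC) lt_h'.
have sub12 := cat_subseq sub1 sub2.
have u12 := subseq_uniq sub12 upp'.
have C12 : {subset (x1 :: p1) ++ (x2 :: p2) <= C} by move=> z /(mem_subseq sub12)/sub.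
have [q0 [q1 [mid [uQ eQ sQ]]]] : exists q0 q1 mid,
    [/\ uniq (q0 :: q1 :: mid), {subset q0 :: q1 :: mid <= Q} & size mid = 3 * b + 2].
  have : size (enum Q) = 3 * b + 4 by rewrite -cardE.
  have : uniq (enum Q) by apply: enum_uniq.
  have : {subset enum Q <= Q} by move=> z; rewrite mem_enum.
  case: (enum Q) => [|q0 [|q1 mid]] sQ uQ; rewrite ?addnS //= => -[cQ].
  by exists q0, q1, mid; split=> //; rewrite cQ addn2.
have sNA z : z \in A -> [/\ z \notin S1, z \notin S2 & z \notin S3].
  by rewrite !inE !negb_or => /andP[/andP[-> ->] ->].
have x1A : x1 \in A by apply/(subsetP CA)/C12; rewrite mem_head.
have x2A : x2 \in A by apply/(subsetP CA)/C12; rewrite mem_cat mem_head orbT.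
have y1A : last x1 p1 \in A by apply/(subsetP CA)/C12; rewrite mem_cat mem_last.
have y2A : last x2 p2 \in A by apply/(subsetP CA)/C12; rewrite mem_cat mem_last orbT.
have q0Q : q0 \in Q by apply: eQ; rewrite mem_head.
have q1Q : q1 \in Q by apply: eQ; rewrite !inE eqxx orbT.
have q0A := subsetP QA _ q0Q; have q1A := subsetP QA _ q1Q.
have con u v (B : {set T}) : A \subset B -> cl u = i -> cl v = i ->
    connect (induced r B) u v.
  move=> AB cu cv; apply: connect_inducedS AB _ _ _.
  by rewrite -eq_class; apply/eqP; rewrite -/cl cu cv.
(* The cycle runs along [p1], through [S1], along [p2], through [S2], the clique and [S3], back to
   [x1]. Each skeleton avoids the earlier ones, so the connections are disjoint. *)
case: link1 => sS1 cS1 /(_ (last x1 p1) x2) lk1.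
have [|||s1 [rs1 us1 ss1]] := lk1.
- by have [? _ _] := sNA _ y1A; rewrite !inE andbT.
- by have [? _ _] := sNA _ x2A; rewrite !inE andbT.
- by apply: con => //; apply: subsetT.
case: link2 => sS2 cS2 /(_ (last x2 p2) q0) lk2.
have [|||s2 [rs2 us2 ss2]] := lk2.
- by have [? ? _] := sNA _ y2A; rewrite !inE; apply/andP.
- by have [? ? _] := sNA _ q0A; rewrite !inE; apply/andP.
- by apply: con => //; [rewrite setCS /S0 -setUA subsetUl | apply: clQ].
case: link3 => sS3 cS3 /(_ q1 x1) lk3.
have [|||s3 [rs3 us3 ss3]] := lk3.
- by have [? ? ?] := sNA _ q1A; rewrite !inE negb_or; apply/and3P.
- by have [? ? ?] := sNA _ x1A; rewrite !inE negb_or; apply/and3P.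
- by apply: con => //; [rewrite setCS subsetUl | apply: clQ].
have size_le (s : seq T) (S : {set T}) : uniq s -> {subset s <= S} -> size s <= #|S|.
  by move=> us sS; rewrite -(card_uniqP us); apply/subset_leq_card/subsetP.
have le1 := leq_trans (size_le _ _ us1 ss1) cS1.
have le2 := leq_trans (size_le _ _ us2 ss2) cS2.
have le3 := leq_trans (size_le _ _ us3 ss3) cS3.
(* Besides [q0] and [q1], exactly [j] clique vertices make up for short skeleton paths. *)
pose j := 3 * b - (size s1 + size s2 + size s3).
pose m := take j mid; have sm : size m = j.
  by rewrite size_takel // sQ (leq_trans (leq_subr _ _)) // leq_addr.
have subm z : z \in m -> z \in mid by apply: mem_take.
pose t := s2 ++ q0 :: rcons m q1 ++ s3.
have rt : path r (last x2 p2) (rcons t x1).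
  rewrite /t rcons_cat cat_path; move: rs2; rewrite rcons_path => /andP[-> rq0] /=.
  rewrite rq0 rcons_cat cat_path last_rcons rs3 andbT; apply: clique_path.
    move=> u v uin vin; apply: Q_clique; apply: eQ.
      by move: uin; rewrite !(inE, mem_rcons) => /or3P[->|->|/subm->]; rewrite ?orbT.
    by move: vin; rewrite !(inE, mem_rcons) => /or3P[->|->|/subm->]; rewrite ?orbT.
  move: uQ; rewrite /= !inE negb_or mem_rcons rcons_uniq inE negb_or.
  case/and3P=> /andP[-> q0N] q1N um; rewrite take_uniq // andbT /=.
  by rewrite (contraNN (subm q0) q0N) (contraNN (subm q1) q1N).
have tQ z : z \in t -> [|| z \in S2, z \in S3 | z \in Q].
  rewrite /t !(mem_cat, inE, mem_rcons) => /or4P[/ss2->//|/eqP->|zm|/ss3->];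
    rewrite ?q0Q ?orbT //.
  case/predU1P: zm => [->|/subm zm]; first by rewrite q1Q !orbT.
  by rewrite (eQ z) ?orbT // !inE zm !orbT.
have notC z : z \in C -> [&& z \notin S0, z \notin Q & z \notin R].
  move=> zC; have := subsetP CA z zC; rewrite in_setC => -> /=.
  by have /negbT := disjointFr C_disj zC; rewrite in_setU negb_or andbC.
have S12 z : z \in S2 -> z \notin S1 by move/(subsetP sS2); rewrite inE.
have S123 z : z \in S3 -> (z \notin S1) && (z \notin S2).
  by move/(subsetP sS3); rewrite !inE negb_or.
have QS z : z \in Q -> [/\ z \notin S1, z \notin S2 & z \notin S3].
  by move/(subsetP QA)/sNA.
have ut : uniq t.
  move: uQ; rewrite /= !inE negb_or => /and3P[/andP[q01 q0N] q1N um].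
  rewrite /t cat_uniq us2 /= cat_uniq us3 rcons_uniq take_uniq // andbT.
  rewrite (contraNN (subm q1) q1N) !(mem_cat, mem_rcons, inE, negb_or) q01.
  rewrite (contraNN (subm q0) q0N) /=.
  have q0N3 : q0 \notin s3 by have [_ _] := QS _ q0Q; apply: contraNN => /ss3.
  have q0N2 : q0 \notin s2 by have [_ + _] := QS _ q0Q; apply: contraNN => /ss2.
  rewrite q0N2 q0N3 /= andbT; apply/andP; split; apply/hasPn=> z /=.
    rewrite mem_cat mem_rcons inE -orbA => /or3P[/eqP->|/subm zm|/ss3/S123/andP[_]].
    - by have [_ + _] := QS _ q1Q; apply: contraNN => /ss2.
    - have [|_ + _] := QS z; first by apply: eQ; rewrite !inE zm !orbT.
      by apply: contraNN => /ss2.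
    - by apply: contraNN => /ss2.
  move/ss3; apply: contraTN; rewrite mem_rcons inE => /predU1P[->|/subm zm].
    by have [_ _ ->] := QS _ q1Q.
  by have [|_ _ ->] := QS z; first by apply: eQ; rewrite !inE zm !orbT.
have notR z : (z \in S0) || (z \in Q) -> z \notin R.
  by move=> zSQ; rewrite (disjointFl R_disj) // in_setU.
have coh_e : subrel coh e by move=> u v /and3P[].
have st : size s1 + size t + 2 = 3 * b + 4.
  have -> : size t = size s2 + (j + 2 + size s3).
    by rewrite /t size_cat /= size_cat size_rcons sm addn2.
  have : size s1 + size s2 + size s3 <= 3 * b by clear -le1 le2 le3; lia.
  rewrite /j; clear; lia.
have st0 z : z \in s1 ++ t -> (z \in S0) || (z \in Q).
  rewrite mem_cat !inE => /orP[/ss1->//|/tQ/or3P[]->]; by rewrite ?orbT.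
have u_all : uniq ((x1 :: p1) ++ (x2 :: p2) ++ s1 ++ t).
  rewrite catA cat_uniq; apply/and3P; split=> //.
    apply/hasPn=> z /st0 zs; apply: contraTN zs => /C12/notC/and3P[zS zQ _].
    by rewrite negb_or zS zQ.
  rewrite cat_uniq; apply/and3P; split=> //.
  apply/hasPn=> z /tQ zt; apply/negP=> /ss1 zS1.
  case/or3P: zt => [/S12|/S123/andP[]|/QS[]]; by rewrite zS1.
have R_all : {in (x1 :: p1) ++ (x2 :: p2) ++ s1 ++ t, forall z, z \notin R}.
  by move=> z; rewrite catA mem_cat => /orP[/C12/notC/and3P[]|/st0/notR].
have [|c [ec uc sc]] := assemble_cycle e_sym r_common
  (sub_path coh_e ep1) rs1 (sub_path coh_e ep2) rt u_all R_all.
  by rewrite st.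
exists c; split=> //; rewrite sc st sp1 sp2 eh.
by clear -le_n; lia.
Qed.

End Closing.

(** * Partition into robust components *)

Section RobustComponents.

Variables (T : finType) (e : rel T).

Definition same_part (Z : {set T}) (t : T -> {set T}) (x y : T) := (y \notin Z) && (t y == t x).

(** Labels are sets because a part will be named by the unordered pair of a class and a majority
    class. *)
Definition part (Z : {set T}) (t : T -> {set T}) (l : {set T}) := [set x in ~: Z | t x == l].

Definition robust_parts (s : nat) (Z : {set T}) (t : T -> {set T}) := [/\ #|Z| <= s,
  {in ~: Z, forall x, #|[set y | e x y && ~~ same_part Z t x y]| <= s} &
  forall l n, 2 <= n -> 2 * n + s <= #|part Z t l| ->
    {in part Z t l, forall x, n + s <= #|[set y in part Z t l | e x y]|} ->
  exists c, [/\ cycle e c, uniq c & size c = 2 * n]].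

End RobustComponents.

Section Decomposition.

Variables (T : finType) (e : rel T) (tau k : nat) (A : {set T}).
Hypotheses (e_sym : symmetric e)
  (indep_card : forall B : {set T}, independent (linked e tau) B -> #|B| <= k).

(** Markov's inequality applied to [sum_incoherent]. *)
Lemma card_incoherent_vertices (theta s : nat) :
  #|[set x in A :\: split_vertices e tau A theta |
       s <= 4 * #|incoherent_nbrs e tau A theta x|]| * s <= 8 * (#|T| * (k * theta)).
Proof.
set W := A :\: _; set X := [set x in W | _].
apply: (@leq_trans (4 * \sum_(x in W) #|incoherent_nbrs e tau A theta x|)); last first.
  have := sum_incoherent A e_sym indep_card theta; rewrite -/W; lia.
rewrite -sum_nat_const big_distrr /=.
rewrite [leqRHS](bigID (mem X)) /= -[leqLHS]addn0 leq_add //.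
rewrite [leqRHS](eq_bigl (mem X)); last first.
  by move=> x; apply/andP/idP => [[]//|xX]; split=> //; case/setIdP: xX.
by apply: leq_sum => x /setIdP[].
Qed.

End Decomposition.

(** [tau] is the link threshold and [G * tau] the slack. Skeletons and clique have constant size and
    the reservoir has at most [tau / 8] vertices, so for large [tau] the slack absorbs them all. *)
Lemma robust_partition (K : nat) : 0 < K -> exists G tau0, 0 < G /\
  forall tau (T : finType) (e : rel T), tau0 <= tau ->
    symmetric e -> irreflexive e ->
    #|T| <= K * (G * tau) -> (forall x, G * tau <= #|nbhd e x|) ->
  exists Z t, robust_parts e (G * tau) Z t.
Proof.
move=> K0; pose k := 2 * K; pose b := k + 2 * k ^ 2; pose q := 3 * b + 4.
(* With theta = H * tau and s = G * tau, these constants give both the split and the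
   incoherent vertices size at most s / 16. *)
have [H eH] : {H | H = 4096 * K ^ 4} by exists (4096 * K ^ 4).
have [G eG] : {G | G = 256 * K ^ 2 * H} by exists (256 * K ^ 2 * H).
have H0 : 0 < H by rewrite eH muln_gt0 expn_gt0 K0.
have G0 : 0 < G by rewrite eG muln_gt0 H0 muln_gt0 expn_gt0 K0.
have [M cliqueM] := clique_in_large_set q k.
pose N := 4 * K * G.
have [t1 growth] := exp_beats_quadratic ((K * G) ^ 2) (8 * (q * N)).
exists G, (t1 + M + 100 * q); split=> // tau T e le_tau e_sym e_irr leT deg.
set s := G * tau; pose theta := H * tau.
have q0 : 0 < q by rewrite /q addnS.
have tau_t1 : t1 <= tau by rewrite (leq_trans _ le_tau) // -addnA leq_addr.
have tau_M : M <= tau by rewrite (leq_trans _ le_tau) // -addnA addnCA leq_addr.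
have tau_q : 100 * q <= tau by rewrite (leq_trans _ le_tau) // leq_addl.
have tau0 : 0 < tau by apply: leq_trans tau_q; rewrite muln_gt0.
have le_ts : 256 * tau <= s.
  by rewrite /s leq_mul2r eG -mulnA leq_pmulr ?orbT // muln_gt0 expn_gt0 K0.
have s0 : 0 < s by rewrite muln_gt0 G0.
pose r := linked e tau.
have r_sym : symmetric r by exact: linked_sym.
have indep (B : {set T}) : independent r B -> #|B| <= k.
  apply: (independent_linked_card s0) => //.
  rewrite /s leq_mul2r; apply/orP; right.
  rewrite eG -mulnn -!mulnA; apply: leq_mul => //; apply: leq_pmulr.
  by rewrite muln_gt0 K0.
have [S1 [_ cS1 lk1]] := skeleton r_sym indep setT.
have [S2 [sS2 cS2 lk2]] := skeleton r_sym indep (~: S1).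
have [S3 [sS3 cS3 lk3]] := skeleton r_sym indep (~: (S1 :|: S2)).
pose S0 := S1 :|: S2 :|: S3; pose A := ~: S0.
have cS0 : #|S0| <= 3 * b.
  rewrite (leq_trans (leq_card_setU _ _)) // mulSnr leq_add // mul2n -addnn.
  by rewrite (leq_trans (leq_card_setU _ _)) // leq_add.
pose X1 := split_vertices e tau A theta.
have cX1 : 16 * #|X1| <= s.
  have eHH : H ^ 2 = 16 * K ^ 2 * G by rewrite eG -mulnn {1}eH; clear; lia.
  have leT2 : #|T| ^ 2 <= (K * (G * tau)) ^ 2 by rewrite leq_sqr.
  have := leq_trans (card_split_vertices tau A e_sym theta) (leq_mul leT2 (leqnn tau)).
  rewrite -/X1 -/s.
  have c0 : 0 < K ^ 2 * s * tau by rewrite !muln_gt0 K0 G0 tau0.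
  have -> : #|X1| * theta ^ 2 = 16 * #|X1| * (K ^ 2 * s * tau).
    by rewrite /theta expnMn eHH /s; clear; lia.
  have -> : (K * s) ^ 2 * tau = s * (K ^ 2 * s * tau) by rewrite expnMn; clear; lia.
  by rewrite leq_pmul2r.
pose inc := incoherent_nbrs e tau A theta.
pose X2 := [set x in A :\: X1 | s <= 4 * #|inc x|].
have cX2 : 16 * #|X2| <= s.
  have le1 : #|X2| * s <= 8 * (#|T| * (k * theta)) := card_incoherent_vertices A e_sym indep theta s.
  have le2 : #|X2| * s <= 8 * (K * s * (k * theta)).
    by rewrite (leq_trans le1) // leq_mul2l leq_mul2r leT orbT.
  have : #|X2| * s <= 16 * K ^ 2 * H * tau * s.
    by apply: leq_trans le2 _; rewrite /k /theta; clear; lia.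
  rewrite leq_pmul2r // => le3; rewrite /s eG.
  by move: le3; clear; lia.
pose Z := S0 :|: X1 :|: X2.
have cZ : 16 * #|Z| <= 3 * s.
  have : #|Z| <= #|S0| + #|X1| + #|X2|.
    rewrite (leq_trans (leq_card_setU _ _)) // leq_add2r.
    by rewrite (leq_trans (leq_card_setU _ _)).
  have : 3 * b <= q by rewrite leq_addr.
  by move: cX1 cX2 cS0 tau_q le_ts; clear; lia.
(* A coherent edge exchanges class and majority class, so both ends get the same unordered pair. *)
pose t x := [set class e tau A x; major e tau A x].
pose coh := coherent e tau A.
have coh_sym : symmetric coh by exact: coherent_sym.
have coh_t x y : coh x y -> t x = t y.
  by case/and3P=> _ /eqP yx /eqP xy; rewrite /t -yx xy setUC.
have inW x : x \notin Z -> x \in A :\: X1 by rewrite !inE !negb_or => /andP[/andP[-> ->]].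
have small_inc x : x \notin Z -> 4 * #|inc x| < s.
  move=> xZ; rewrite ltnNge; apply: contraNN xZ => le_s; rewrite in_setU [x \in X2]inE le_s andbT.
  by case: (boolP (x \in A :\: X1)); rewrite ?orbT // !inE negb_and negbK => /orP[->|];
    rewrite ?orbT // negbK => ->.
exists Z, t; split.
- by move: cZ; clear; lia.
- move=> x; rewrite in_setC => xZ.
  have : [set y | e x y && ~~ same_part Z t x y] \subset Z :|: inc x.
    apply/subsetP=> y; rewrite inE => /andP[exy]; rewrite negb_and negbK in_setU.
    case/orP=> [->//|tyx]; have [//|yZ /=] := boolP (y \in Z).
    rewrite inE inW //= exy; apply: contraNN tyx => /coh_t txy.
    by rewrite txy.
  move/subset_leq_card/leq_trans; apply; apply: leq_trans (leq_card_setU _ _) _.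
  by move: (small_inc x xZ) cZ; clear; lia.
move=> l n n2; set C := part Z t l => leC degC.
have [x0 x0C] : exists x, x \in C.
  by apply/card_gt0P; apply: leq_trans leC; move: s0; clear; lia.
pose i := class e tau A x0.
have CZ x : x \in C -> x \notin Z by rewrite inE => /andP[]; rewrite in_setC.
have CA : C \subset A.
  by apply/subsetP=> x /CZ/inW/setDP[].
have clC x : x \in C -> class e tau A x = i \/ major e tau A x = i.
  rewrite inE => /andP[_ /eqP tx]; move: x0C; rewrite inE => /andP[_].
  rewrite -tx => /eqP/setP/(_ i); rewrite !inE eqxx /= => /esym/orP[]/eqP->; by [left | right].
have degcoh x : x \in C -> 4 * n + 3 * s <= 4 * #|[set y in C | coh x y]|.
  move=> xC; have : [set y in C | e x y] \subset [set y in C | coh x y] :|: inc x.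
    apply/subsetP=> y /setIdP[yC exy]; apply/setUP.
    have [cxy|ncxy] := boolP (coh x y); [left | right]; first by apply/setIdP.
    by apply/setIdP; split; [apply/inW/CZ | rewrite exy].
  move/subset_leq_card => le1; have le2 := leq_trans le1 (leq_card_setU _ _).
  move: (small_inc x (CZ x xC)) (degC x xC) le2; clear; lia.
have [y1 y1C cxy1] : exists2 y, y \in C & coh x0 y.
  have : 0 < #|[set y in C | coh x0 y]| by move: (degcoh x0 x0C) s0; clear; lia.
  by case/card_gt0P=> y /setIdP[]; exists y.
pose V := [set y in A | class e tau A y == i].
have leV : M <= #|V|.
  apply: (@leq_trans #|[set z in C | coh y1 z]|).
    by move: (degcoh y1 y1C) tau_M le_ts; clear; lia.
  apply/subset_leq_card/subsetP=> z /setIdP[zC /and3P[_ /eqP cz _]].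
  by rewrite inE (subsetP CA) //= cz /i; case/and3P: cxy1 => _ _ /eqP ->.
have [Q [sQV cQ rQ]] := cliqueM T r V r_sym indep leV.
have deg_r x y : r x y -> tau <= #|nbhd e x :&: nbhd e y| by case/andP.
(* [close_up] needs [n] to be at least [q]. For small [n], a cyclic order of [n] clique vertices is
   expanded directly, with common neighbours taken outside [Q]. *)
have [le_nq|lt_qn] := leqP n q.
  pose p := take n (enum Q).
  have sp : size p = n by rewrite size_takel // -cardE cQ.
  have up : uniq p by rewrite take_uniq // enum_uniq.
  have pQ : {subset p <= Q} by move=> z /mem_take; rewrite mem_enum.
  have common x y : r x y -> n <= #|[set z in ~: Q | e x z && e y z]|.
    move=> /deg_r le1.
    have -> : [set z in ~: Q | e x z && e y z] = (nbhd e x :&: nbhd e y) :\: Q.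
      by apply/setP=> z; rewrite !inE.
    rewrite cardsD; have := subset_leq_card (subsetIr (nbhd e x :&: nbhd e y) Q).
    by rewrite cQ; move: le1 tau_q le_nq q0; clear; lia.
  case: p sp up pQ => [|z p] sp up pQ; first by rewrite -sp in n2.
  have rp : path r (last z p) (z :: p).
    rewrite /= clique_path // ?andbT; last by move=> u v uin vin; apply: rQ; apply: pQ.
    apply: rQ; rewrite ?pQ ?mem_head ?mem_last //.
    by case: p sp up {pQ} => [sp|y p _ /andP[zp _]]; [rewrite -sp in n2 |
      apply: contraNneq zp => <- /=; apply: mem_last].
  have [z' z'p||c [ec uc sc]] := expand_cycle e_sym common rp (erefl _) up.
  - by rewrite in_setC negbK pQ.
  - by rewrite sp.
  by exists c; rewrite sc sp.
have [k' lt_k' le_k'] := growth tau tau_t1.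
pose I := {u : T * T | r u.1 u.2}.
pose F (u : I) := nbhd e (val u).1 :&: nbhd e (val u).2.
have cI : #|{: I}| < 2 ^ k'.
  rewrite card_sig; apply: leq_ltn_trans (max_card _) (leq_ltn_trans _ lt_k').
  by rewrite card_prod mulnn -expnMn leq_sqr -mulnA.
have cY : #|S0 :|: Q| <= 2 * q.
  rewrite (leq_trans (leq_card_setU _ _)) // mul2n -addnn cQ leq_add2r.
  by rewrite (leq_trans cS0) // leq_addr.
have le_k'' : 8 * (q * (N * k')) <= tau by apply: leq_trans le_k'; rewrite !mulnA.
(* Half of each common neighbourhood pays for the hitting argument; the other half absorbs [S0], [Q]
   and the points of earlier rounds. *)
have [|||R [cR dR hitR]] := @reservoir _ {: I} F (S0 :|: Q) N (tau %/ 2) k' q _ _ cI.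
- by move: tau_q q0; clear; lia.
- have le4 : tau <= 4 * (tau %/ 2) by move: tau_q q0; clear; lia.
  have -> : N * (tau %/ 2) = K * (G * (4 * (tau %/ 2))) by rewrite /N; clear; lia.
  by rewrite (leq_trans leT) // !leq_mul2l le4 !orbT.
- move=> [u ru]; apply: leq_trans (deg_r _ _ ru).
  by move: cY le_k'' tau_q q0; move: (q * (N * k')) => w; clear; lia.
have common x y : r x y -> q <= #|[set z in R | e x z && e y z]|.
  move=> rxy; apply: leq_trans (hitR (exist _ (x, y) rxy)) _.
  by apply/subset_leq_card/subsetP=> z; rewrite !inE => /andP[/andP[-> ->] ->].
have cR8 : 8 * #|R| <= tau.
  by apply: leq_trans le_k''; rewrite leq_mul2l.
pose C' := C :\: (R :|: Q).
have cRQ : 8 * #|R :|: Q| <= tau + 8 * q.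
  have := leq_card_setU R Q => -[+ _]; rewrite cQ; move: cR8; clear; lia.
have C'C : C' \subset C by apply: subsetDl.
apply: (@close_up T e tau b e_sym e_irr S1 S2 S3 Q R C' i) => //.
- by apply: subset_trans sQV _; apply/subsetP=> x /setIdP[].
- by move=> x /(subsetP sQV)/setIdP[_ /eqP].
- exact: subset_trans C'C CA.
- by rewrite disjoint_sym disjoints_subset setCD subsetUr.
- by move=> x /(subsetP C'C)/clC.
- exact: ltnW.
- have := cardsID (R :|: Q) C; have := subset_leq_card (subsetIr C (R :|: Q)).
  by rewrite -/C'; move: cRQ leC tau_q le_ts q0; clear; lia.
move=> x xC'; have xC := subsetP C'C x xC'.
have : [set y in C | coh x y] \subset [set y in C' | coh x y] :|: (R :|: Q).
  apply/subsetP=> y /setIdP[yC cxy]; have [yRQ|yNRQ] := boolP (y \in R :|: Q).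
    by apply/setUP; right.
  by apply/setUP; left; apply/setIdP; split=> //; apply/setDP.
move/subset_leq_card => le1; have le2 := leq_trans le1 (leq_card_setU _ _).
suff : n + 4 <= #|[set y in C' | coh x y]| by [].
by move: (degcoh x xC) le2 cRQ tau_q le_ts q0; clear; lia.
Qed.

(** * A cycle inside a neighbourhood *)

Section Relative.

Variables (T : finType) (e : rel T) (B : {set T}).

Lemma card_sub_set (P : pred T) :
  #|[set y in B | P y]| = #|[set u : {x | x \in B} | P (val u)]|.
Proof.
rewrite -(card_imset _ val_inj); apply: eq_card => y.
apply/setIdP/imsetP => [[yB Py]|[u + ->]]; last by rewrite inE; split=> //; apply: valP.
by exists (exist _ y yB); rewrite ?inE.
Qed.

Definition part_in (Z : {set T}) (t : T -> {set T}) (l : {set T}) :=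
  [set x in B | (x \notin Z) && (t x == l)].

Definition robust_parts_in (s : nat) (Z : {set T}) (t : T -> {set T}) := [/\ #|Z| <= s,
  {in B :\: Z, forall x, #|[set y in B | e x y && ~~ same_part Z t x y]| <= s} &
  forall l n, 2 <= n -> 2 * n + s <= #|part_in Z t l| ->
    {in part_in Z t l, forall x, n + s <= #|[set y in part_in Z t l | e x y]|} ->
  exists c, [/\ cycle e c, uniq c, size c = 2 * n & {subset c <= B}]].

(** Transfers a partition of the subgraph on [B] to sets of the ambient type. Taking images is
    injective on labels, so parts correspond exactly. *)
Lemma robust_parts_val (s : nat) (Z : {set {x | x \in B}}) t :
    robust_parts (fun u v : {x | x \in B} => e (val u) (val v)) s Z t ->
  exists Z' t', robust_parts_in s Z' t'.
Proof.
case=> cZ inZ cyc; pose vals (U : {set {x | x \in B}}) := [set val u | u in U].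
pose t' x := if insub x is Some u then vals (t u) else set0.
have vals_inj : injective vals by apply: imset_inj; apply: val_inj.
have t'E u : t' (val u) = vals (t u) by rewrite /t' valK.
have ZE u : (val u \in vals Z) = (u \in Z) by rewrite mem_imset //; apply: val_inj.
have sameE u v : same_part (vals Z) t' (val u) (val v) = same_part Z t u v.
  by rewrite /same_part ZE !t'E (inj_eq vals_inj).
exists (vals Z), t'; split; first by rewrite card_imset //; apply: val_inj.
  move=> x /setDP[xB xZ]; pose u : {x | x \in B} := exist _ x xB.
  rewrite card_sub_set -[x]/(val u).
  apply: leq_trans (inZ u _); last by rewrite in_setC -ZE.
  by apply/subset_leq_card/subsetP=> v; rewrite !inE sameE.
move=> l n n2 leC degC.
have /card_gt0P[x0 x0C] : 0 < #|part_in (vals Z) t' l|.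
  by apply: leq_trans leC; rewrite addn_gt0 muln_gt0 (ltnW n2).
have x0B : x0 \in B by move: x0C => /setIdP[].
have [l' el] : exists l', l = vals l'.
  move: x0C => /setIdP[_ /andP[_ /eqP<-]]; exists (t (exist _ x0 x0B)).
  by rewrite -t'E.
have partE u : (val u \in part_in (vals Z) t' l) = (u \in part Z t l').
  by rewrite !inE ZE t'E el (inj_eq vals_inj); have -> : sval u \in B := valP u.
have sub_cardE (P : pred T) : #|[set y in part_in (vals Z) t' l | P y]| =
    #|[set u in part Z t l' | P (val u)]|.
  have -> : [set y in part_in (vals Z) t' l | P y] =
      [set y in B | (y \in part_in (vals Z) t' l) && P y].
    by apply/setP=> y; rewrite !inE -!andbA; case: (y \in B).
  by rewrite card_sub_set; apply: eq_card => u; rewrite [LHS]in_set [RHS]in_set /= partE.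
have [|u uC|c [ec uc sc]] := cyc l' n n2.
- have := sub_cardE predT.
  rewrite (_ : [set y in part_in _ _ _ | _] = part_in (vals Z) t' l); last by apply/setP=> y; rewrite in_set andbT.
  by rewrite (_ : [set y in part _ _ _ | _] = part Z t l') => [<-//|]; apply/setP=> y; rewrite in_set andbT.
- by rewrite -sub_cardE degC // partE.
exists (map val c); split.
- by rewrite cycle_map.
- by rewrite map_inj_uniq //; apply: val_inj.
- by rewrite size_map.
- by move=> _ /mapP[u _ ->]; apply: valP.
Qed.

End Relative.

Lemma cycle_in_neighbourhood (E : nat) : 0 < E -> exists m0, forall n m (T : finType) (e : rel T),
    m0 <= m -> n < m -> 2 <= n -> symmetric e -> irreflexive e ->
    #|T| = 2 * m + n + m %/ E -> (forall x, #|~: nbhd e x| <= m) ->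
  exists v c, [/\ cycle e c, uniq c, size c = 2 * n & {subset c <= nbhd e v}].
Proof.
move=> E0; have K0 : 0 < 320 * E by rewrite muln_gt0.
have [G [tau0 [G0 DL]]] := robust_partition K0.
exists (40 * E * G * tau0.+1) => n m T e le_m lt_nm n2 e_sym e_irr cT nonadj.
(* This makes [s = G * tau] at most a fortieth of the slack [m %/ E], yet still of order [m / E], so
   that [#|T|] is at most [320 * E * s]. *)
pose tau := m %/ (40 * E * G).
have D0 : 0 < 40 * E * G by rewrite muln_gt0 G0 muln_gt0 E0.
have le_tau : tau0 < tau by rewrite leq_divRL // mulnC.
have [s es] : {s | s = G * tau} by exists (G * tau).
have s0 : 0 < s by rewrite es muln_gt0 G0 (leq_ltn_trans _ le_tau).
have le_sE : 40 * s <= m %/ E.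
  rewrite leq_divRL //; apply: leq_trans (leq_divM m (40 * E * G)).
  by rewrite -/tau es; move: (tau) => x; clear; lia.
have le_ms : m <= 80 * E * s.
  have := ltn_ceil m D0; rewrite -/tau => lt1.
  have : 40 * E * G * tau.+1 <= 40 * E * G * (2 * tau).
    by rewrite leq_mul2l; apply/orP; right; move: (tau) le_tau => x; clear; lia.
  rewrite mulnC in lt1; move/(leq_trans (ltnW lt1)); rewrite es.
  by move: (tau) => x; clear; lia.
have le_div : m %/ E <= m by apply: leq_div.
have leT : #|T| <= 320 * E * s.
  by rewrite cT; move: le_ms le_div lt_nm; clear; lia.
have deg x : #|T| <= #|nbhd e x| + m by rewrite -(cardsC (nbhd e x)) leq_add2l.
have cap (B : {set T}) x : #|B| <= #|[set y in B | e x y]| + m.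
  rewrite -(cardsID (nbhd e x) B) leq_add //.
    by apply/subset_leq_card/subsetP=> y /setIP[yB]; rewrite !inE => ->; rewrite yB.
  apply: leq_trans (nonadj x); apply/subset_leq_card/subsetP=> y.
  by rewrite in_setC => /setDP[].
pose good := exists v c, [/\ cycle e c, uniq c, size c = 2 * n & {subset c <= nbhd e v}].
have split_nbhd v : good \/ exists (Z : {set T}) (t : T -> {set T}), [/\ #|Z| <= s,
    {in nbhd e v :\: Z, forall x,
       #|[set y in nbhd e v | e x y && ~~ same_part Z t x y]| <= s} &
    forall l, #|part_in (nbhd e v) Z t l| < 2 * n + s].
  (* Two vertices miss at most [2 * m] vertices together, leaving [n + m %/ E] common neighbours. *)
  have degv x : n + 40 * s <= #|[set y in nbhd e v | e x y]|.
    by move: (cap (nbhd e v) x) (deg v) cT le_sE; clear; lia.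
  have [||||Z0 [t0 rp0]] := DL tau _ (fun x y : {x | x \in nbhd e v} => e (val x) (val y)) (ltnW le_tau).
  - by move=> x y /=; apply: e_sym.
  - by move=> x /=; apply: e_irr.
  - by rewrite -es card_sig (leq_trans (max_card _)).
  - move=> u; rewrite -es; have := degv (val u); rewrite card_sub_set => le1.
    by apply: leq_trans le1; move: s0; clear; lia.
  have [Z [t [cZ nbrs cyc]]] := robust_parts_val rp0; rewrite -es in cZ nbrs cyc.
  have [/existsP[l le_l]|] := boolP [exists l, 2 * n + s <= #|part_in (nbhd e v) Z t l|].
    left; exists v; apply: (cyc l) => // x xC.
    have /setIdP[xN /andP[xZ /eqP tx]] := xC.
    have xNZ : x \in nbhd e v :\: Z by apply/setDP.
    have : [set y in nbhd e v | e x y] \subset [set y in part_in (nbhd e v) Z t l | e x y]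
        :|: [set y in nbhd e v | e x y && ~~ same_part Z t x y].
      apply/subsetP=> y /setIdP[yN exy]; apply/setUP.
      have [/andP[yZ /eqP ty]|ns] := boolP (same_part Z t x y); [left | right].
        by do 2 (apply/setIdP; split=> //); rewrite yZ ty tx eqxx.
      by apply/setIdP; rewrite exy.
    move/subset_leq_card => le1; have le2 := leq_trans le1 (leq_card_setU _ _).
    by move: (nbrs x xNZ) (degv x) le2 s0; clear; lia.
  rewrite negb_exists => /forallP small; right; exists Z, t; split=> // l.
  by rewrite ltnNge.
have in_part v Z t x y : y \in nbhd e v -> same_part Z t x y -> y \in part_in (nbhd e v) Z t (t x).
  by move=> yN yx; apply/setIdP.
have [u _] : exists u : T, u \in T by apply/card_gt0P; rewrite cT; move: n2 (m %/ E) => + w; clear; lia.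
have [//|[Z [t [cZ nbrs small]]]] := split_nbhd u.
have [v] : exists v, v \in nbhd e u :\: Z.
  apply/card_gt0P; have := cardsID Z (nbhd e u); have := subset_leq_card (subsetIr (nbhd e u) Z).
  by move: cZ (deg u) cT le_sE s0 n2; clear; lia.
move=> vNZ; have /setDP[vN vZ] := vNZ.
have [//|[Zv [tv [cZv nbrsv smallv]]]] := split_nbhd v.
pose C := part_in (nbhd e u) Z t (t v).
have [x [xC vx xZv]] : exists x, [/\ x \in C, e v x & x \notin Zv].
  have : [set y in nbhd e u | e v y] \subset [set y in C | e v y && (y \notin Zv)] :|: Zv
      :|: [set y in nbhd e u | e v y && ~~ same_part Z t v y].
    apply/subsetP=> y /setIdP[yN evy]; rewrite !in_setU !in_set evy /=.
    have yN' : e u y by move: yN; rewrite inE.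
    by rewrite yN' -/(same_part Z t v y) /=; case: (y \in Zv); rewrite ?orbT //= andbT orbF orbN.
  move/subset_leq_card => le1; have le2 := leq_trans le1 (leq_card_setU _ _).
  have := leq_card_setU [set y in C | e v y && (y \notin Zv)] Zv => -[le3 _].
  have : 0 < #|[set y in C | e v y && (y \notin Zv)]|.
    by move: (nbrs v vNZ) le2 le3 cZv (cap (nbhd e u) v) (deg u) cT le_sE s0 n2; clear; lia.
  by case/card_gt0P=> x /setIdP[xC /andP[vx xZv]]; exists x.
have xNZv : x \in nbhd e v :\: Zv by apply/setDP; rewrite inE.
pose C' := part_in (nbhd e v) Zv tv (tv x).
(* Since a part is smaller than [2 * n + s], it does not fill [N(v)]. A vertex [y] of another part
   misses nearly all of [C'], which bounds [C'] by [m + s]. *)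
have [y yN yC'] : exists2 y, y \in nbhd e v :\: Zv & y \notin C'.
  have : 0 < #|(nbhd e v :\: Zv) :\: C'|.
    have := cardsID Zv (nbhd e v); have := subset_leq_card (subsetIr (nbhd e v) Zv).
    have := cardsID C' (nbhd e v :\: Zv); have := subset_leq_card (subsetIr (nbhd e v :\: Zv) C').
    by move: (smallv (tv x)); rewrite -/C'; move: cZv (deg v) cT le_sE s0 lt_nm; clear; lia.
  by case/card_gt0P=> y /setDP[? ?]; exists y.
have leC' : #|C'| <= m + s.
  apply: leq_trans (cap C' y) _; rewrite addnC leq_add2l.
  apply: leq_trans (nbrsv y yN); apply/subset_leq_card/subsetP=> z /setIdP[zC eyz].
  have /setIdP[zN /andP[zZ /eqP tz]] := zC.
  apply/setIdP; split=> //; rewrite eyz; apply: contra yC' => /andP[_ /eqP ty].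
  have /setDP[yN' yZ] := yN.
  by apply/setIdP; split=> //; rewrite yZ /= -tz ty eqxx.
have codeg : #|nbhd e v :&: nbhd e x| <= m + 2 * s.
  have : nbhd e v :&: nbhd e x \subset C' :|: [set y in nbhd e v | e x y && ~~ same_part Zv tv x y].
    apply/subsetP=> z /setIP[zN]; rewrite inE => exz; apply/setUP.
    have [sz|nsz] := boolP (same_part Zv tv x z); [left; exact: in_part | right].
    by apply/setIdP; rewrite exz.
  move/subset_leq_card => le1; have le2 := leq_trans le1 (leq_card_setU _ _).
  by move: (nbrsv x xNZv) le2 leC'; clear; lia.
have xNZ : x \in nbhd e u :\: Z.
  by have /setIdP[? /andP[? _]] := xC; apply/setDP.
have tx : t x = t v by have /setIdP[_ /andP[_ /eqP]] := xC.
have leC : #|nbhd e u :&: (nbhd e v :|: nbhd e x)| <= #|C| + 2 * s.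
  have : nbhd e u :&: (nbhd e v :|: nbhd e x) \subset
      C :|: [set y in nbhd e u | e v y && ~~ same_part Z t v y]
        :|: [set y in nbhd e u | e x y && ~~ same_part Z t x y].
    apply/subsetP=> z /setIP[zN zvx].
    have [sz|nsz] := boolP (same_part Z t v z).
      by rewrite !in_setU in_part.
    have nsz' : ~~ same_part Z t x z by rewrite /same_part tx.
    by case/setUP: zvx; rewrite in_set => ez; rewrite !in_setU !in_set ez nsz ?nsz' -(in_set (e u)) zN ?orbT.
  move/subset_leq_card => le1; have le2 := leq_trans le1 (leq_card_setU _ _).
  have := leq_card_setU C [set y in nbhd e u | e v y && ~~ same_part Z t v y] => -[le3 _].
  by move: (nbrs x xNZ) (nbrs v vNZ) le2 le3; clear; lia.
have := cardsUI (nbhd e u) (nbhd e v :|: nbhd e x).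
have := cardsUI (nbhd e v) (nbhd e x).
have : #|nbhd e u :|: (nbhd e v :|: nbhd e x)| <= #|T| by apply: max_card.
(* Inclusion-exclusion twice gives [I >= 3 * (N - m) - Y - N >= 2 * n + 2 * j - 2 * s], hence
   [c >= 2 * n + 76 * s]. *)
have arith (N j U VX W I V X Y c : nat) : I <= c + 2 * s -> Y <= m + 2 * s -> N <= U + m ->
    N <= V + m -> N <= X + m -> N = 2 * m + n + j -> 40 * s <= j -> 0 < s -> c < 2 * n + s ->
    W <= N -> VX + Y = V + X -> W + I = U + VX -> False.
  clear; lia.
have leU : #|nbhd e u :|: (nbhd e v :|: nbhd e x)| <= #|T| by apply: max_card.
exfalso; apply: (arith _ _ _ _ _ _ _ _ _ _ leC codeg (deg u) (deg v) (deg x) cT le_sE s0 (small (t v)) leU).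
  exact: cardsUI.
exact: cardsUI.
Qed.

(** * The Ramsey bound *)

Lemma contains_star (G : sgraph) (v : G) (m : nat) :
  m <= #|nbhd (@adj G) v| -> contains G (star m).
Proof.
move=> le_m; pose f (x : star m) : G :=
  if x is Some i then enum_val (widen_ord le_m i) else v.
have f_adj i : adj v (f (Some i)) by have := enum_valP (widen_ord le_m i); rewrite inE.
apply/existsP; exists (finfun f); apply/andP; split.
  apply/injectiveP=> -[i|] [j|]; rewrite !ffunE //.
  - by move=> /enum_val_inj/(congr1 val)/= /val_inj ->.
  - by move=> fi; have := f_adj i; rewrite fi adj_irr.
  - by move=> fj; have := f_adj j; rewrite -fj adj_irr.
apply/forallP=> -[i|]; apply/forallP=> -[j|]; rewrite !ffunE; apply/implyP=> //= _.
- by rewrite adj_sym f_adj.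
- exact: f_adj.
Qed.

Lemma cycle_nth (T : eqType) (e : rel T) (x0 : T) (c : seq T) (i : nat) :
  cycle e c -> i < size c -> e (nth x0 c i) (nth x0 c (i.+1 %% size c)).
Proof.
case: c => // x p /(pathP x0) ec lt_i; have := ec i; rewrite size_rcons => /(_ lt_i).
move: lt_i; rewrite ltnS leq_eqVlt => /predU1P[->|lt_i].
  by rewrite modnn nth_rcons ltnn eqxx -rcons_cons nth_rcons /= ltnSn.
by rewrite modn_small ?ltnS // nth_rcons lt_i -rcons_cons nth_rcons /= ltnS ltnW.
Qed.

Lemma contains_wheel (G : sgraph) (v : G) (c : seq G) :
    cycle (@adj G) c -> uniq c -> {subset c <= nbhd (@adj G) v} ->
  contains G (wheel (size c)).
Proof.
move=> ec uc sub; pose f (x : wheel (size c)) : G := if x is Some i then nth v c i else v.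
have f_adj i : adj v (f (Some i)) by have := sub _ (mem_nth v (ltn_ord i)); rewrite inE.
apply/existsP; exists (finfun f); apply/andP; split.
  apply/injectiveP=> -[i|] [j|]; rewrite !ffunE //.
  - by move=> /= /eqP; rewrite nth_uniq // => /eqP/val_inj ->.
  - by move=> fi; have := f_adj i; rewrite fi adj_irr.
  - by move=> fj; have := f_adj j; rewrite -fj adj_irr.
apply/forallP=> -[i|]; apply/forallP=> -[j|]; rewrite !ffunE; apply/implyP=> //.
- case/andP=> _ /orP[]/eqP ij.
    by have := cycle_nth v ec (ltn_ord i); rewrite -ij.
  by have := cycle_nth v ec (ltn_ord j); rewrite -ij adj_sym.
- by move=> _; rewrite adj_sym f_adj.
Qed.

Lemma arrows_star_wheel (E : nat) : 0 < E -> exists m0, forall n m : nat,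
    m0 <= m -> n < m -> 2 <= n ->
  arrows (star m) (wheel (2 * n)) (2 * m + n + m %/ E).
Proof.
case/cycle_in_neighbourhood=> m0 H; exists m0 => n m le_m lt_nm n2.
apply/forallP=> c; set N := 2 * m + n + m %/ E in c *.
have [/existsP[v le_v]|small] :=
    boolP [exists v : 'I_N, m <= #|nbhd (color_rel c true) v|].
  by rewrite (@contains_star (color_graph c true) v).
rewrite negb_exists in small; move/forallP in small.
have [|x|v [p [ep up <- sub]]] := H n m 'I_N (color_rel c false) le_m lt_nm n2
    (@color_sym N c false) (@color_irr N c false).
- by rewrite card_ord.
(* Without a star, fewer than [m] vertices are joined to [x] in colour 1; adding [x] itself gives at
   most [m] missed vertices. *)
- have := small x; rewrite -ltnNge; apply: leq_trans.
  have : ~: nbhd (color_rel c false) x \subset x |: nbhd (color_rel c true) x.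
    apply/subsetP=> y; rewrite !inE /color_rel [y == x]eq_sym.
    by case: eqP => //= _; case: (c _).
  move/subset_leq_card/leq_trans; apply.
  by rewrite cardsU1 -add1n leq_add2r leq_b1.
by rewrite (@contains_wheel (color_graph c false) v) ?orbT.
Qed.

Import Order.TTheory GRing.Theory Num.Theory.
Local Open Scope ring_scope.

Theorem theorem1p3 (R : realType) (eps : R) (eps_gt0 : 0 < eps) :
  exists m0 : nat, forall n m : nat,
    (m0 <= m)%N -> (n < m)%N -> (2 <= n)%N ->
    (ramsey (star m) (wheel (2 * n)%N))%:R <= (2 + eps) * m%:R + n%:R :> R.
Proof.
(* An integer above [1 / eps], so that the slack [m %/ E] is at most [eps * m]. *)
pose E := (Num.truncn eps^-1).+1.
have lt_E : eps^-1 < E%:R by apply: truncnS_gt.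
have [m0 H] := arrows_star_wheel (ltn0Sn _ : (0 < E)%N).
exists m0 => n m le_m lt_nm n2.
have := H n m le_m lt_nm n2; rewrite /ramsey; case: ex_minnP => r _ min_r /min_r le_r.
apply: (@le_trans _ _ (2 * m + n + m %/ E)%N%:R); first by rewrite ler_nat.
have le_div : (m %/ E)%N%:R <= eps * m%:R :> R.
  rewrite -(ler_pM2l (_ : 0 < eps^-1)) ?invr_gt0 // mulrA mulVf ?gt_eqF // mul1r.
  apply: (@le_trans _ _ (E%:R * (m %/ E)%N%:R)).
    by rewrite ler_wpM2r ?ler0n // ltW.
  by rewrite -natrM ler_nat mulnC leq_divM.
by rewrite natrD natrD natrM (mulrDl 2 eps) [leRHS]addrAC lerD2l.
Qed.
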